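(* Let $A$ be a Noetherian ring and let $I$ be an ideal in $A$. Let $\mathcal{F} = \{J_n\}_{n \geq 0}$ be a multiplicative filtration of ideals in $A$ such that $\mathcal{R}(\mathcal{F}) = \bigoplus_{n \geq 0} J_n$ is a finitely generated $A$-algebra. Let $\mathcal{R} = A[It]$ and assume $I^n \subseteq J_n$ for all $n \geq 1$. Then the following two assertions are equivalent: (1) For all $i \geq 0$ we have $H^i_{\mathcal{R}_+}(\mathcal{R}(\mathcal{F}))_n = 0$ for all $n \gg 0$. (2) $J_n \subseteq \overline{I^n}$ for all $n \geq 1$.
   Context: Rings are commutative with identity. A multiplicative filtration of ideals in $A$ is a sequence $\{J_n\}_{n\ge 0}$ of ideals with $J_0 = A$, $J_{n+1} \subseteq J_n$ and $J_m J_n \subseteq J_{m+n}$ for all $m,n \ge 0$. Its Rees algebra $\mathcal{R}(\mathcal{F}) = \bigoplus_{n\ge 0} J_n$ is identified with the graded subring $\bigoplus_{n \ge 0} J_n t^n$ of the polynomial ring $A[t]$. $\mathcal{R} = A[It] = \bigoplus_{n\ge 0} I^n t^n \subseteq A[t]$ is the Rees algebra of $I$, graded by degree in $t$, and $\mathcal{R}_+ = \bigoplus_{n \ge 1} I^n t^n$. Since $I^n \subseteq J_n$ for all $n \geq 1$, $\mathcal{R}(\mathcal{F})$ is a graded $\mathcal{R}$-module. $H^i_{\mathcal{R}_+}(-)$ denotes the $i$-th local cohomology functor of $\mathcal{R}$-modules with support in the ideal $\mathcal{R}_+$; for a graded module it is naturally $\mathbb{Z}$-graded, and $H^i_{\mathcal{R}_+}(-)_n$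 is its degree $n$ component. ''For all $n \gg 0$'' means for all sufficiently large $n$. For an ideal $K$ of $A$, $\overline{K}$ denotes the integral closure of $K$ in $A$. *)

(* Defs.v *)
From HB Require Import structures.
From mathcomp Require Import all_boot all_order all_algebra.
From mathcomp Require Import boolp classical_sets functions cardinality fsbigop.

Set Implicit Arguments.
Unset Strict Implicit.
Unset Printing Implicit Defensive.

Import Order.TTheory GRing.Theory Num.Theory.

Local Open Scope classical_set_scope.
Local Open Scope ring_scope.

Section Ideals.
Variable R : comNzRingType.
Implicit Types I J K : set R.

Definition is_ideal J : Prop :=
  [/\ J 0, forall x y, J x -> J y -> J (x + y) & forall a x, J x -> J (a * x)].

Definition ideal_gen (S : set R) : set R := smallest is_ideal S.

Definition noetherian : Prop :=
  forall J, is_ideal J -> exists s : seq R, J = ideal_gen [set` s].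

Definition ideal_mul I J : set R :=
  ideal_gen [set z | exists x y, [/\ I x, J y & z = x * y]].

Fixpoint ideal_exp I (n : nat) : set R :=
  if n is n'.+1 then ideal_mul I (ideal_exp I n') else setT.

Definition integral_closure K : set R :=
  [set x | exists (n : nat) (a : nat -> R),
     [/\ (0 < n)%N,
         forall i, (1 <= i <= n)%N -> ideal_exp K i (a i) &
         x ^+ n + \sum_(1 <= i < n.+1) a i * x ^+ (n - i) = 0]].

Lemma ideal_gen_ideal (S : set R) : is_ideal (ideal_gen S).
Proof.
split=> [M [[? ? ?] _] //|x y hx hy M MP|a x hx M MP].
- by case: (MP) => -[_ MD _] _; apply: MD; [exact: hx|exact: hy].
- by case: (MP) => -[_ _ MM] _; apply: MM; exact: hx.
Qed.

Lemma ideal_exp_ideal I n : is_ideal (ideal_exp I n).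
Proof. by case: n => [|n]; [split|exact: ideal_gen_ideal]. Qed.

Lemma ideal_expS_sub I n : ideal_exp I n.+1 `<=` ideal_exp I n.
Proof.
apply: smallest_sub; first exact: ideal_exp_ideal.
by move=> _ [x [y [_ hy ->]]]; have [_ _] := ideal_exp_ideal I n; apply.
Qed.

Lemma ideal_exp_mul I m n :
  ideal_mul (ideal_exp I m) (ideal_exp I n) `<=` ideal_exp I (m + n).
Proof.
apply: smallest_sub; first exact: ideal_exp_ideal.
move=> _ [x [y [hx hy ->]]].
elim: m x hx => [|m IH] x hx.
  by have [_ _] := ideal_exp_ideal I n; apply.
have [h0 hD hM] := ideal_exp_ideal I (m.+1 + n).
apply: (hx [set z | ideal_exp I (m.+1 + n) (z * y)]); split.
- split=> /= [|u v hu hv|a u hu]; first by rewrite mul0r.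
  + by rewrite mulrDl; exact: hD.
  + by rewrite -mulrA; exact: hM.
- move=> _ [u [v [hu hv ->]]] /=; rewrite -mulrA; apply: sub_gen_smallest.
  by exists u, (v * y); split=> //; exact: IH.
Qed.

End Ideals.

Record multFiltration (A : comNzRingType) := MultFiltration {
  filt :> nat -> set A;
  filt_ideal : forall n, is_ideal (filt n);
  filt0 : filt 0%N = setT;
  filt_dec : forall n, filt n.+1 `<=` filt n;
  filt_mul : forall m n, ideal_mul (filt m) (filt n) `<=` filt (m + n)%N
}.

Definition adic (A : comNzRingType) (I : set A) : multFiltration A :=
  MultFiltration (ideal_exp_ideal I) erefl (@ideal_expS_sub A I)
    (@ideal_exp_mul A I).

Section ReesAlgebra.
Variables (A : comNzRingType) (F : multFiltration A).

Definition rees_set : set {poly A} := [set p | forall n : nat, F n p`_n].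

Definition rees_pred : {pred {poly A}} := fun p => `[< rees_set p >].

Lemma filtM m n x y : F m x -> F n y -> F (m + n)%N (x * y).
Proof.
by move=> hx hy; apply: filt_mul; apply: sub_gen_smallest; exists x, y.
Qed.

Lemma filtN n x : F n x -> F n (- x).
Proof. by move=> hx; rewrite -mulN1r; have [_ _] := filt_ideal F n; apply. Qed.

Lemma filt_sum n (T : finType) (P : pred T) (f : T -> A) :
  (forall i, P i -> F n (f i)) -> F n (\sum_(i | P i) f i).
Proof.
by move=> h; have [h0 hD _] := filt_ideal F n; elim/big_ind: _ => //.
Qed.

Lemma rees_subring : subring_closed rees_pred.
Proof.
split=> [|p q /asboolP hp /asboolP hq|p q /asboolP hp /asboolP hq];
  apply/asboolP=> n.
- rewrite coef1; case: eqP => [->|_]; first by rewrite filt0.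
  by have [] := filt_ideal F n.
- rewrite coefB; have [_ hD _] := filt_ideal F n.
  by apply: hD => //; exact: filtN.
- rewrite coefM; apply: filt_sum => i _.
  by rewrite -[X in F X](subnKC (ltnSE (ltn_ord i))); exact: filtM.
Qed.

HB.instance Definition _ :=
  GRing.isSubringClosed.Build {poly A} rees_pred rees_subring.

Record rees := Rees { rees_poly :> {poly A}; _ : rees_poly \in rees_pred }.

HB.instance Definition _ := [isSub for rees_poly].
HB.instance Definition _ := [Choice of rees by <:].
HB.instance Definition _ := [SubChoice_isSubComNzRing of rees by <:].

Definition rees_deg (n : int) : set rees :=
  [set p | forall k : nat, k%:Z <> n -> (rees_poly p)`_k = 0].

End ReesAlgebra.

Definition is_subalgebra (A : comNzRingType) (S : set {poly A}) : Prop :=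
  [/\ forall a, S a%:P, forall p q, S p -> S q -> S (p + q) &
      forall p q, S p -> S q -> S (p * q)].

Definition rees_finitely_generated (A : comNzRingType) (F : multFiltration A) :=
  exists s : seq {poly A}, rees_set F = smallest (@is_subalgebra A) [set` s].

(* V is the internal direct sum of the subgroups deg n, n in Z.  The support
   condition is needed because \sum_(n \in D) is 0 on infinite supports. *)
Definition is_grading (V : zmodType) (deg : int -> set V) : Prop :=
  (forall n, deg n 0 /\ (forall x y, deg n x -> deg n y -> deg n (x - y))) /\
  (forall x : V, exists! c : int -> V,
     [/\ forall n, deg n (c n), finite_set [set n | c n <> 0] &
         x = \sum_(n \in [set: int]) c n]).

Record gradedRing := GradedRing {
  gring :> comNzRingType;
  gring_deg : int -> set gring;
  gring_grading : is_grading gring_deg;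
  gring1 : gring_deg 0 1;
  gringM : forall m n x y,
    gring_deg m x -> gring_deg n y -> gring_deg (m + n) (x * y)
}.

Record gradedModule (R : gradedRing) := GradedModule {
  gmod :> lmodType R;
  gmod_deg : int -> set gmod;
  gmod_grading : is_grading gmod_deg;
  gmodZ : forall m n (a : R) x,
    gring_deg m a -> gmod_deg n x -> gmod_deg (m + n) (a *: x)
}.

Record gradedHom (R : gradedRing) (M N : gradedModule R) := GradedHom {
  ghom :> {linear M -> N};
  ghom_deg : forall n x, gmod_deg n x -> gmod_deg n (ghom x)
}.

Section LocalCohomology.
Variable R : gradedRing.
Implicit Types M N E : gradedModule R.

Definition graded_injective E : Prop :=
  forall M N (i : gradedHom M N) (f : gradedHom M E), injective i ->
  exists g : gradedHom N E, forall x, g (i x) = f x.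

Record injResolution M := InjResolution {
  res :> nat -> gradedModule R;
  res_diff : forall i, gradedHom (res i) (res i.+1);
  res_aug : gradedHom M (res 0%N);
  res_inj : forall i, graded_injective (res i);
  res_aug_inj : injective res_aug;
  res_exact0 : forall x, res_diff 0%N x = 0 <-> exists y, x = res_aug y;
  res_exactS : forall i x,
    res_diff i.+1 x = 0 <-> exists y, x = res_diff i y
}.

Variable J : set R.

Definition torsion M : set M :=
  [set x | exists k : nat, forall r, ideal_exp J k r -> r *: x = 0].

Section Resolution.
Variables (M : gradedModule R) (E : injResolution M).

Definition lc_cocycles (i : nat) : set (E i) :=
  [set x | torsion x /\ res_diff E i x = 0].

Definition lc_coboundaries (i : nat) : set (E i) :=
  match i return set (E i) with
  | 0%N => [set 0]
  | i'.+1 => [set x | exists2 y, torsion y & x = res_diff E i' y]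
  end.

End Resolution.

(* H^i_J(M)_n = 0 for a homogeneous ideal J, where H^i_J is the i-th right
   derived functor of the J-torsion functor on graded R-modules.  The degree n
   part of cocycles / coboundaries is the image of the cocycles of degree n.
   By the comparison theorem for injective resolutions the condition does not
   depend on E. *)
Definition local_cohomology_deg_eq0 M (i : nat) (n : int) : Prop :=
  forall E : injResolution M,
    @lc_cocycles M E i `&` @gmod_deg R (E i) n `<=` @lc_coboundaries M E i.

End LocalCohomology.

Section ReesGrading.
Variables (A : comNzRingType) (F : multFiltration A).

Lemma reesB (p q : rees F) : rees_poly (p - q) = rees_poly p - rees_poly q.
Proof. exact: (raddfB (val : rees F -> {poly A})). Qed.

Lemma reesD (p q : rees F) : rees_poly (p + q) = rees_poly p + rees_poly q.
Proof. exact: (raddfD (val : rees F -> {poly A})). Qed.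

Lemma rees0 : rees_poly (0 : rees F) = 0.
Proof. exact: (raddf0 (val : rees F -> {poly A})). Qed.

Lemma coef_rees_sum (c : int -> rees F) (k : nat) :
    finite_set [set n | c n <> 0] -> (forall n, rees_deg n (c n)) ->
  (rees_poly (\sum_(n \in [set: int]) c n))`_k = (rees_poly (c k%:Z))`_k.
Proof.
move=> fc dc.
have fcT : finite_set ([set: int] `&` c @^-1` [set~ 0]) by rewrite setTI.
have sE n : (n \in finite_support 0 setT c) = (c n != 0).
  rewrite in_finite_support // setTI.
  by apply/idP/idP => [/set_mem/eqP //|/eqP h]; apply/mem_set.
rewrite (big_morph (fun p : rees F => (rees_poly p)`_k) (id1 := 0) (op1 := +%R));
  last 2 first.
- by move=> p q; rewrite [rees_poly _]reesD coefD.
- by rewrite [rees_poly _]rees0 coef0.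
have dc0 n : n != k%:Z -> (rees_poly (c n))`_k = 0.
  by move=> nk; apply: dc => kn; rewrite kn eqxx in nk.
have [ck|ck] := boolP (k%:Z \in finite_support 0 setT c).
  rewrite (bigD1_seq k%:Z ck (finite_support_uniq _ _ _)) /=.
  by rewrite big1 ?addr0 // => n; exact: dc0.
rewrite big1_seq => [|n /= ns].
  by move: ck; rewrite sE negbK => /eqP ->; rewrite rees0 coef0.
by apply: dc0; apply: contraNneq ck => <-.
Qed.

Lemma rees_deg_grading : is_grading (@rees_deg A F).
Proof.
split=> [n|p].
  split=> [k _|p q hp hq k hk]; first by rewrite rees0 coef0.
  by rewrite reesB coefB hp ?hq ?subr0.
pose m (n : int) : {poly A} :=
  if n is Posz k then (rees_poly p)`_k *: 'X^k else 0.
have coef_m (n : int) (k : nat) :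
    (m n)`_k = if k%:Z == n then (rees_poly p)`_k else 0.
  case: n => l /=; last by rewrite coef0.
  rewrite coefZ coefXn eqz_nat; case: eqP => [->|_]; by rewrite ?mulr1 ?mulr0.
have m_rees n : m n \in rees_pred F.
  apply/asboolP => k; rewrite coef_m; case: eqP => _.
    by case: p @m coef_m => p /= /asboolP.
  by have [] := filt_ideal F k.
pose c n := Rees (m_rees n).
have cE n : rees_poly (c n) = m n by [].
have dc n : rees_deg n (c n).
  by move=> k kn; rewrite cE coef_m; case: eqP.
have fc : finite_set [set n | c n <> 0].
  pose s := [seq k%:Z | k <- iota 0 (size (rees_poly p))].
  apply: (@sub_finite_set _ _ [set` s]); last exact: finite_seq.
  move=> [k|k] /= cn; last by case: cn; apply: val_inj; rewrite /= [RHS]rees0.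
  apply/mapP; exists k => //; rewrite mem_iota add0n /= ltnNge.
  apply: contra_notN cn => hk; apply: val_inj => /=.
  by rewrite nth_default // scale0r [RHS]rees0.
exists c; split.
  split=> //; apply: val_inj; apply/polyP => k /=.
  by rewrite coef_rees_sum // cE coef_m eqxx.
move=> c' [dc' fc' pE]; apply/funext => n; apply: val_inj; apply/polyP => k.
change ((m n)`_k = (rees_poly (c' n))`_k).
have [kn|kn] := eqVneq k%:Z n; last first.
  by rewrite coef_m (negPf kn) dc' //; apply/eqP.
by rewrite coef_m kn eqxx pE coef_rees_sum // kn.
Qed.

Lemma rees1 : rees_poly (1 : rees F) = 1.
Proof. exact: (rmorph1 (val : rees F -> {poly A})). Qed.

Lemma reesM (p q : rees F) : rees_poly (p * q) = rees_poly p * rees_poly q.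
Proof. exact: (rmorphM (val : rees F -> {poly A})). Qed.

Lemma rees_deg1 : rees_deg 0 (1 : rees F).
Proof. by move=> k k0; rewrite rees1 coef1; case: eqP k0 => // ->. Qed.

Lemma rees_degM m n (p q : rees F) :
  rees_deg m p -> rees_deg n q -> rees_deg (m + n) (p * q).
Proof.
move=> hp hq k kmn; rewrite reesM coefM big1 // => i _.
have [im|/eqP im] := eqVneq i%:Z m; last by rewrite hp ?mul0r.
rewrite hq ?mulr0 // => kn; apply: kmn.
by rewrite -im -kn -PoszD subnKC // -ltnS.
Qed.

Definition rees_gradedRing : gradedRing :=
  GradedRing rees_deg_grading rees_deg1 rees_degM.

End ReesGrading.

(* A[It], and below its ideal of elements without constant term. *)
Definition rees_ring (A : comNzRingType) (I : set A) : gradedRing :=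
  rees_gradedRing (adic I).

Definition rees_plus (A : comNzRingType) (I : set A) : set (rees_ring I) :=
  [set p : rees (adic I) | (rees_poly p)`_0 = 0].
Arguments rees_plus {A} I.

Section ReesModule.
Variables (A : comNzRingType) (I : set A) (F : multFiltration A).
Hypothesis IF : forall n, (1 <= n)%N -> ideal_exp I n `<=` F n.

Lemma rees_incl_subproof (r : rees (adic I)) : rees_poly r \in rees_pred F.
Proof.
case: r => p /= /asboolP hp; apply/asboolP=> -[|n]; first by rewrite filt0.
by apply: IF => //; exact: hp n.+1.
Qed.

Definition rees_incl (r : rees (adic I)) : rees F := Rees (rees_incl_subproof r).

(* Alias of R(F) that records the inclusion of A[It] in R(F), so that it can
   carry an A[It]-module structure. *)
Definition rees_restr of (forall n, (1 <= n)%N -> ideal_exp I n `<=` F n) : Type :=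
  rees F.

Local Notation V := (rees_restr IF).

HB.instance Definition _ := GRing.Zmodule.copy V (rees F).

Definition rees_scale (r : rees_ring I) (x : V) : V := rees_incl r * (x : rees F).

Lemma rees_scaleA a b x : rees_scale a (rees_scale b x) = rees_scale (a * b) x.
Proof.
rewrite /rees_scale mulrA; congr (_ * _); apply: val_inj.
by rewrite [LHS]reesM [RHS]reesM.
Qed.

Lemma rees_scale1 : left_id 1 rees_scale.
Proof.
move=> x; rewrite /rees_scale (_ : rees_incl 1 = 1) ?mul1r //.
exact: val_inj.
Qed.

Lemma rees_scaleDr : right_distributive rees_scale +%R.
Proof. by move=> a x y; exact: mulrDr. Qed.

Lemma rees_scaleDl x : {morph rees_scale^~ x : a b / a + b}.
Proof.
move=> a b; rewrite /rees_scale -[RHS]mulrDl; congr (_ * _).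
exact: val_inj.
Qed.

HB.instance Definition _ := GRing.Zmodule_isLmodule.Build (rees_ring I) V
  rees_scaleA rees_scale1 rees_scaleDr rees_scaleDl.

Lemma rees_degZ m n (a : rees_ring I) (x : V) :
  gring_deg m a -> @rees_deg A F n x -> @rees_deg A F (m + n) (a *: x).
Proof. by move=> ha hx; apply: rees_degM. Qed.

(* R(F) as a graded A[It]-module, by restriction of scalars along the inclusion
   of A[It] in R(F). *)
Definition rees_module : gradedModule (rees_ring I) :=
  @GradedModule (rees_ring I) V (@rees_deg A F)
    (@rees_deg_grading A F) rees_degZ.

End ReesModule.

(* Main.v *)
(* Let x_1, ..., x_r generate R_+ in degree 1 and let E be a graded injective
   resolution of M = R(F).  Since R = A[It] is noetherian, a graded injective
   module modulo its x_1-torsion has bijective multiplication by x_1; hence the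
   Koszul complex K(x_1^k, ..., x_r^k) of E^i modulo R_+-torsion is exact, and
   Koszul cohomology of M can be compared, degree by degree, with the cohomology
   of the torsion subcomplex of E, which is local cohomology.
   If local cohomology vanishes in high degrees, so does the last Koszul
   cohomology M/R_+M, i.e. J_(n+1) = I J_n for large n, and the determinant trick
   gives (2).  Conversely (2) makes M a noetherian R-module; a devissage on
   quotients M/N shows that the cohomology of K(x_1^k, ..., x_r^k; M) vanishes
   in high degrees, uniformly in k.  Any torsion class is killed by some
   x_1^k, ..., x_r^k, hence is a cocycle for one of these complexes, and
   vanishes. *)
Require Import Defs.
From HB Require Import structures.
From mathcomp Require Import all_boot all_order all_algebra.
From mathcomp Require Import perm generic_quotient ring_quotient ring zify.
From mathcomp Require Import boolp classical_sets functions cardinality fsbigop.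

Set Implicit Arguments.
Unset Strict Implicit.
Unset Printing Implicit Defensive.

Import Order.TTheory GRing.Theory Num.Theory.

Local Open Scope classical_set_scope.
Local Open Scope ring_scope.

(** * Gradings and graded submodules *)

(** The exponent [k] for which x_1^k, ..., x_r^k kill a torsion class depends on the class, while
    the degree bound may depend only on the cohomological degree: this forces the uniformity in [k].
    Vanishing is quantified over all graded injective resolutions. So (1) yields something only once
    a resolution has been built, here from characters with values in Q/Z; and in the converse
    nothing is known of the resolution besides injectivity and exactness, so that divisibility by
    x_1 has to be extracted from injectivity and noetherianity alone. Chain conditions are stated
    for subsets of A[t] stable under a set of multipliers: the same statements then serve for ideals
    of A[It] and for submodules of R(F). *)

Definition is_subgroup (V : zmodType) (M : set V) :=
  M 0 /\ forall x y, M x -> M y -> M (x - y).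

Lemma is_subgroupD (V : zmodType) (M : set V) x y :
  is_subgroup M -> M x -> M y -> M (x + y).
Proof.
move=> [M0 MB] hx hy; rewrite -(opprK y); apply: (MB) => //.
by rewrite -sub0r; exact: MB.
Qed.

Section Subgroups.
Variables (V : zmodType) (M : set V).
Hypothesis MP : is_subgroup M.

Lemma subgroup0 : M 0. Proof. by case: MP. Qed.
Lemma subgroupB x y : M x -> M y -> M (x - y).
Proof. by have [_ h] := MP; exact: h. Qed.
Lemma subgroupN x : M x -> M (- x).
Proof. by rewrite -sub0r; exact: (subgroupB subgroup0). Qed.
Lemma subgroup_sum (I : Type) (s : seq I) (P : pred I) (f : I -> V) :
  (forall i, P i -> M (f i)) -> M (\sum_(i <- s | P i) f i).
Proof.
move=> h; apply: big_ind => //; first exact: subgroup0.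
by move=> x y; exact: (is_subgroupD MP).
Qed.

End Subgroups.

Section Grading.
Variables (V : zmodType) (deg : int -> set V).

Lemma fsbig_seqW (c : int -> V) (s : seq int) : uniq s ->
  (forall n, n \notin s -> c n = 0) ->
  \sum_(n \in [set: int]) c n = \sum_(n <- s) c n.
Proof.
move=> us h; rewrite (fsbigE s) // => [|n _]; last exact: h.
by apply: eq_bigl => n; rewrite in_setT.
Qed.

Lemma big_seq_widen (c : int -> V) (r t : seq int) : uniq r -> uniq t ->
  {subset r <= t} -> (forall n, n \notin r -> c n = 0) ->
  \sum_(n <- r) c n = \sum_(n <- t) c n.
Proof.
move=> ur ut rt h; rewrite -(fsbig_seqW ur h) -(fsbig_seqW ut) // => n nt.
by apply: h; apply: contra nt => /rt.
Qed.

Lemma finite_support_notin (c : int -> V) n : finite_set [set n | c n <> 0] ->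
  n \notin finite_support 0 setT c -> c n = 0.
Proof.
move=> fc; rewrite in_finite_support ?setTI // => /negP h.
by apply: contrapT => h'; apply: h; rewrite inE.
Qed.

(* A grading can be read off from a family of additive maps which restrict to
   the projections on homogeneous elements. *)
Lemma grading_of_proj (p : int -> V -> V) :
    (forall n, deg n 0 /\ (forall x y, deg n x -> deg n y -> deg n (x - y))) ->
    (forall n x y, p n (x - y) = p n x - p n y) ->
    (forall n x, deg n x -> p n x = x) ->
    (forall m n x, deg n x -> n <> m -> p m x = 0) ->
    (forall x, exists s : seq int, exists c : int -> V,
       [/\ uniq s, forall n, deg n (c n) & x = \sum_(n <- s) c n]) ->
  is_grading deg.
Proof.
move=> degB pB pid p0 gen; split=> // x.
have pz n : p n 0 = 0 by rewrite -[in LHS](subrr 0) pB subrr.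
have pN n y : p n (- y) = - p n y by rewrite -[in LHS](sub0r y) pB pz sub0r.
have pD n y z : p n (y + z) = p n y + p n z by rewrite -{1}(opprK z) pB pN opprK.
have ps n (s : seq int) c : uniq s -> (forall n, deg n (c n)) ->
    p n (\sum_(m <- s) c m) = if n \in s then c n else 0.
  move=> us dc; rewrite (big_morph (p n) (pD n) (pz n)).
  have h m : m != n -> p n (c m) = 0 by move=> /eqP h; exact: p0 (dc m) h.
  case: ifP => ns; last first.
    by rewrite big1_seq // => m /= ms; apply: h; apply: contraFneq ns => <-.
  by rewrite (bigD1_seq n) //= (pid n) ?big1 ?addr0 // => m; exact: h.
have [s [c [us dc xE]]] := gen x.
have pxE n : p n x = if n \in s then c n else 0 by rewrite xE ps.
exists (fun n => p n x); split.
  have fs : finite_set [set n | p n x <> 0].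
    apply: (@sub_finite_set _ _ [set` s]); last exact: finite_seq.
    by move=> n /=; rewrite pxE; case: ifP.
  split=> //.
    by move=> n; rewrite pxE; case: ifP => // _; have [] := degB n.
  rewrite (fsbig_seqW us) => [|n /negPf ns]; last by rewrite pxE ns.
  by rewrite [LHS]xE !big_seq; apply: eq_bigr => n ns; rewrite pxE ns.
move=> c' [dc' fc' xE']; apply/funext => n; rewrite xE'.
have h m := @finite_support_notin c' m fc'.
rewrite (fsbig_seqW (finite_support_uniq _ _ _) h) ps ?finite_support_uniq //.
by case: ifPn => // /h ->.
Qed.

Hypothesis gr : is_grading deg.

Lemma grading0 n : deg n 0. Proof. by case: gr => /(_ n) []. Qed.
Lemma gradingB n x y : deg n x -> deg n y -> deg n (x - y).
Proof. by have [/(_ n) [_ h] _] := gr; exact: h. Qed.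
Lemma gradingN n x : deg n x -> deg n (- x).
Proof. by rewrite -sub0r; apply: gradingB; exact: grading0. Qed.
Lemma gradingD n x y : deg n x -> deg n y -> deg n (x + y).
Proof. by move=> hx hy; rewrite -(opprK y); apply/gradingB/gradingN. Qed.

Definition hcomp (n : int) (x : V) : V := projT1 (cid (gr.2 x)) n.

Lemma hcomp_spec x : [/\ forall n, deg n (hcomp n x),
  finite_set [set n | hcomp n x <> 0] & x = \sum_(n \in [set: int]) hcomp n x].
Proof. by rewrite /hcomp; case: cid => c []. Qed.

Lemma hcomp_unique x c : (forall n, deg n (c n)) ->
  finite_set [set n | c n <> 0] -> x = \sum_(n \in [set: int]) c n ->
  forall n, hcomp n x = c n.
Proof.
move=> h1 h2 h3 n; rewrite /hcomp; case: cid => c' [_ /= u].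
by rewrite (u c).
Qed.

Lemma hcomp_deg n x : deg n (hcomp n x). Proof. by case: (hcomp_spec x). Qed.

Lemma hcomp_seq x : exists2 s : seq int, uniq s &
  (x = \sum_(n <- s) hcomp n x) /\ forall n, n \notin s -> hcomp n x = 0.
Proof.
have [_ fc xE] := hcomp_spec x.
exists (finite_support 0 setT (fun n => hcomp n x)); first exact: finite_support_uniq.
by split=> // n; exact: finite_support_notin.
Qed.

Lemma hcomp_uniqueW x (s : seq int) (c : int -> V) : uniq s ->
  (forall n, deg n (c n)) -> (forall n, n \notin s -> c n = 0) ->
  x = \sum_(n <- s) c n -> forall n, hcomp n x = c n.
Proof.
move=> us dc c0 xE; apply: hcomp_unique => //; last by rewrite (fsbig_seqW us).
apply: (@sub_finite_set _ _ [set` s]); last exact: finite_seq.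
by move=> n /= cn; apply: contrapT => /negP /c0.
Qed.

Lemma hcomp_id n x : deg n x -> hcomp n x = x.
Proof.
move=> dx; rewrite (@hcomp_uniqueW x [:: n] (fun m => if m == n then x else 0)) ?eqxx //.
- by move=> m; case: eqP => [->//|_]; exact: grading0.
- by move=> m; rewrite inE; case: eqP.
- by rewrite big_seq1 eqxx.
Qed.

Lemma hcomp_neq m n x : deg n x -> n <> m -> hcomp m x = 0.
Proof.
move=> dx nm; rewrite (@hcomp_uniqueW x [:: n] (fun m => if m == n then x else 0)) ?eqxx //.
- by case: eqP nm => // ->.
- by move=> k; case: eqP => [->//|_]; exact: grading0.
- by move=> k; rewrite inE; case: eqP.
- by rewrite big_seq1 eqxx.
Qed.

Lemma hcompB n x y : hcomp n (x - y) = hcomp n x - hcomp n y.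
Proof.
have [s us [xE hx]] := hcomp_seq x; have [t ut [yE hy]] := hcomp_seq y.
apply: (@hcomp_uniqueW _ (undup (s ++ t)) (fun n => hcomp n x - hcomp n y)).
- exact: undup_uniq.
- by move=> m; apply: gradingB; exact: hcomp_deg.
- by move=> m; rewrite mem_undup mem_cat negb_or => /andP[/hx-> /hy->]; rewrite subrr.
- rewrite sumrB; congr (_ - _); [rewrite [LHS]xE|rewrite [LHS]yE];
    by apply: big_seq_widen; rewrite ?undup_uniq // => m ms;
      rewrite mem_undup mem_cat ms ?orbT.
Qed.

Lemma hcomp0 n : hcomp n 0 = 0.
Proof. by rewrite -[in LHS](subrr 0) hcompB subrr. Qed.
Lemma hcompN n x : hcomp n (- x) = - hcomp n x.
Proof. by rewrite -[in LHS](sub0r x) hcompB hcomp0 sub0r. Qed.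
Lemma hcompD n x y : hcomp n (x + y) = hcomp n x + hcomp n y.
Proof. by rewrite -{1}(opprK y) hcompB hcompN opprK. Qed.

Lemma grading_ind (P : V -> Prop) : P 0 -> (forall x y, P x -> P y -> P (x + y)) ->
  (forall n x, deg n x -> P x) -> forall x, P x.
Proof.
move=> P0 PD Ph x; have [s _ [-> _]] := hcomp_seq x.
by apply: big_ind => // n _; apply: Ph; exact: hcomp_deg.
Qed.

End Grading.

Lemma grading_shift (V : zmodType) (deg : int -> set V) (a : int) :
  is_grading deg -> is_grading (fun n => deg (n - a)).
Proof.
move=> gr; apply: (grading_of_proj (p := fun n => hcomp gr (n - a))).
- by move=> n; split; [exact: grading0 gr _|exact: gradingB gr _].
- by move=> n; exact: hcompB.
- by move=> n x; exact: hcomp_id.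
- by move=> m n x h nm; apply: (hcomp_neq gr h) => /(addIr (- a)).
- move=> x; have [s us [xE h]] := hcomp_seq gr x.
  exists [seq n + a | n <- s], (fun n => hcomp gr (n - a) x); split.
  + by rewrite map_inj_uniq //; exact: addIr.
  + by move=> n; exact: hcomp_deg.
  + by rewrite big_map [LHS]xE; apply: eq_bigr => n _; rewrite addrK.
Qed.

(* Homogeneous elements of a module, independent thanks to the additive
   projections [pd_proj]; their sums form a graded module. *)
Record preGraded (R : gradedRing) := PreGraded {
  pd_mod :> lmodType R;
  pd_deg : int -> set pd_mod;
  pd_proj : int -> pd_mod -> pd_mod;
  pd_degB : forall n,
    pd_deg n 0 /\ (forall x y, pd_deg n x -> pd_deg n y -> pd_deg n (x - y));
  pd_degZ : forall m n (a : R) x,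
    gring_deg m a -> pd_deg n x -> pd_deg (m + n) (a *: x);
  pd_projB : forall n x y, pd_proj n (x - y) = pd_proj n x - pd_proj n y;
  pd_proj_id : forall n x, pd_deg n x -> pd_proj n x = x;
  pd_proj_neq : forall m n x, pd_deg n x -> n <> m -> pd_proj m x = 0
}.

Section GradedSpan.
Variables (R : gradedRing) (D : preGraded R).

(** The subgroup generated by the homogeneous elements. In this form, applying a membership proof to
    a subgroup is an induction. *)
Definition gspan_set : set D := [set x | forall M : set D, is_subgroup M ->
  (forall n, @pd_deg R D n `<=` M) -> M x].

Definition gspan_pred : {pred D} := fun x => `[< gspan_set x >].

Lemma gspan_subgroup : is_subgroup gspan_set.
Proof.
split=> [M [M0 _] _ //|x y hx hy M MP h].
by case: (MP) => _; apply; [exact: hx|exact: hy].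
Qed.

Lemma gspan_deg n : @pd_deg R D n `<=` gspan_set.
Proof. by move=> x hx M _ h; exact: h hx. Qed.

Lemma gspanZ (a : R) x : gspan_set x -> gspan_set (a *: x).
Proof.
have [S0 SB] := gspan_subgroup.
move=> /(_ [set x | gspan_set (a *: x)]); apply.
  by split=> [|u v hu hv] /=; rewrite ?scaler0 // scalerBr; exact: SB.
move=> n u hu /=; elim/(grading_ind (gring_grading R)): a => [|a b ha hb|m a ha].
- by rewrite scale0r.
- by rewrite scalerDl; exact: is_subgroupD gspan_subgroup ha hb.
- exact: (gspan_deg (pd_degZ ha hu)).
Qed.

Lemma gspan_closed : submod_closed gspan_pred.
Proof.
have [S0 SB] := gspan_subgroup; split; first exact/asboolP.
move=> a x y /asboolP hx /asboolP hy; apply/asboolP.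
by apply: is_subgroupD gspan_subgroup _ hy; exact: gspanZ.
Qed.

HB.instance Definition _ := GRing.isSubmodClosed.Build R D gspan_pred gspan_closed.

Record gspan := GSpan { gspan_val :> D; _ : gspan_val \in gspan_pred }.

HB.instance Definition _ := [isSub for gspan_val].
HB.instance Definition _ := [Choice of gspan by <:].
HB.instance Definition _ := [SubChoice_isSubLmodule of gspan by <:].

Definition gspan_degree (n : int) : set gspan := [set x | pd_deg n (gspan_val x)].

Lemma gspanP (x : gspan) : gspan_set (gspan_val x).
Proof. by case: x => x /= /asboolP. Qed.

Lemma gspan_valB (x y : gspan) : gspan_val (x - y) = gspan_val x - gspan_val y.
Proof. exact: (raddfB (val : gspan -> D)). Qed.
Lemma gspan_valD (x y : gspan) : gspan_val (x + y) = gspan_val x + gspan_val y.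
Proof. exact: (raddfD (val : gspan -> D)). Qed.
Lemma gspan_val0 : gspan_val (0 : gspan) = 0.
Proof. exact: (raddf0 (val : gspan -> D)). Qed.
Lemma gspan_valZ a (x : gspan) : gspan_val (a *: x) = a *: gspan_val x.
Proof. by []. Qed.

(** The record leaves the values of [pd_proj] on arbitrary elements free; on the span they are
    homogeneous, by additivity from the homogeneous case. *)
Lemma gspan_proj n x : gspan_set x -> pd_deg n (pd_proj n x).
Proof.
move=> /(_ [set x | pd_deg n (pd_proj n x)]); apply.
  split=> /= [|u v hu hv].
    by rewrite pd_proj_id; have [] := pd_degB D n.
  by rewrite pd_projB; have [_ h] := pd_degB D n; exact: h.
move=> m u hu /=; have [->|/eqP mn] := eqVneq n m; first by rewrite pd_proj_id.
by rewrite (pd_proj_neq hu) //; [have [] := pd_degB D n|exact/nesym].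
Qed.

Lemma gspan_proj_in n (x : gspan) : pd_proj n (gspan_val x) \in gspan_pred.
Proof. by apply/asboolP; exact: (gspan_deg (gspan_proj n (gspanP x))). Qed.

Definition gspan_projection n (x : gspan) : gspan := GSpan (gspan_proj_in n x).

Lemma gspan_grading : is_grading gspan_degree.
Proof.
apply: (grading_of_proj (p := gspan_projection)).
- move=> n; have [h0 hB] := pd_degB D n; split=> [|x y hx hy].
    by change (pd_deg n (gspan_val 0)); rewrite gspan_val0.
  by change (pd_deg n (gspan_val (x - y))); rewrite gspan_valB; exact: hB.
- move=> n x y; apply: val_inj.
  change (pd_proj n (gspan_val (x - y)) =
    gspan_val (gspan_projection n x - gspan_projection n y)).
  by rewrite !gspan_valB pd_projB.
- by move=> n x hx; apply: val_inj; exact: pd_proj_id.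
- move=> m n x hx nm; apply: val_inj.
  change (pd_proj m (gspan_val x) = gspan_val 0).
  by rewrite gspan_val0; exact: pd_proj_neq hx nm.
- move=> x.
  (* The finite sums of homogeneous elements form a subgroup, which therefore contains the span.
     Vanishing outside [s] allows two supports to be merged in a difference. *)
  pose M := [set z | exists s : seq int, exists c : int -> D, [/\ uniq s,
      forall n, n \notin s -> c n = 0, forall n, pd_deg n (c n) &
      z = \sum_(n <- s) c n]].
  have : M (gspan_val x).
    apply: (gspanP x); last first.
      move=> n u hu; exists [:: n], (fun m => if m == n then u else 0).
      split=> //; last by rewrite big_seq1 eqxx.
        by move=> m; rewrite inE; case: eqP.
      by move=> m; case: eqP => [->//|_]; have [] := pd_degB D m.
    split=> [|u v [s [c [us hc dc ->]]] [t [e [ut he de ->]]]].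
      exists [::], (fun=> 0); split=> //; last by rewrite big_nil.
      by move=> n; have [] := pd_degB D n.
    exists (undup (s ++ t)), (fun n => c n - e n); split.
    + exact: undup_uniq.
    + by move=> m; rewrite mem_undup mem_cat negb_or => /andP[/hc-> /he->]; rewrite subrr.
    + by move=> n; have [_ h] := pd_degB D n; exact: h.
    rewrite sumrB; congr (_ - _); apply: big_seq_widen => //;
      rewrite ?undup_uniq // => m ms; by rewrite mem_undup mem_cat ms ?orbT.
  move=> [s [c [us _ dc xE]]].
  have ic n : c n \in gspan_pred by apply/asboolP; exact: (gspan_deg (dc n)).
  exists s, (fun n => GSpan (ic n)); split=> //; apply: val_inj.
  change (gspan_val x = gspan_val (\sum_(n <- s) GSpan (ic n))).
  by rewrite xE (big_morph _ gspan_valD gspan_val0).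
Qed.

Lemma gspan_degreeZ m n (a : R) (x : gspan) :
  gring_deg m a -> gspan_degree n x -> gspan_degree (m + n) (a *: x).
Proof. exact: pd_degZ. Qed.

Definition gspan_module : gradedModule R := GradedModule gspan_grading gspan_degreeZ.

End GradedSpan.

Definition is_submodule (R : pzRingType) (V : lmodType R) (S : set V) :=
  is_subgroup S /\ forall (a : R) x, S x -> S (a *: x).

Section GradedSubmodules.
Variables (R : gradedRing) (N : gradedModule R).

Definition graded_submodule (S : set N) :=
  is_submodule S /\ forall n x, S x -> S (hcomp (gmod_grading N) n x).

Lemma hcompZ m n (a : R) (x : N) : gring_deg m a ->
  hcomp (gmod_grading N) (m + n) (a *: x) = a *: hcomp (gmod_grading N) n x.
Proof.
move=> ha; elim/(grading_ind (gmod_grading N)): x => [|x y hx hy|k x hx].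
- by rewrite scaler0 !hcomp0 scaler0.
- by rewrite scalerDr !hcompD hx hy scalerDr.
- have [<-|/eqP kn] := eqVneq k n.
    by rewrite !hcomp_id //; exact: gmodZ.
  rewrite (hcomp_neq _ hx) // scaler0.
  rewrite (hcomp_neq _ (gmodZ ha hx)) // => /addrI; exact: kn.
Qed.

Section Sub.
Variables (S : set N) (Sg : graded_submodule S).

Let deg n : set N := [set x | S x /\ gmod_deg n x].

Lemma sub_degB n : deg n 0 /\ (forall x y, deg n x -> deg n y -> deg n (x - y)).
Proof.
have [[[S0 SB] _] _] := Sg; split=> [|x y [hx dx] [hy dy]]; split=> //=.
- exact: grading0 (gmod_grading N) n.
- exact: SB.
- exact: (gradingB (gmod_grading N)).
Qed.

Lemma sub_degZ m n (a : R) x : gring_deg m a -> deg n x -> deg (m + n) (a *: x).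
Proof.
have [[_ SZ] _] := Sg; move=> ha [hx dx]; split; first exact: SZ.
exact: gmodZ.
Qed.

Definition sub_preGraded : preGraded R := PreGraded sub_degB sub_degZ
  (@hcompB _ _ (gmod_grading N))
  (fun n x (h : deg n x) => hcomp_id (gmod_grading N) h.2)
  (fun m n x (h : deg n x) => hcomp_neq (gmod_grading N) h.2).

Lemma sub_gspanP x : @gspan_set R sub_preGraded x <-> S x.
Proof.
have [[SG _] Sc] := Sg; split; first by apply=> // n u [].
move=> Sx; have [s _ [-> _]] := hcomp_seq (gmod_grading N) x.
apply: big_ind; first by have [] := gspan_subgroup sub_preGraded.
  by move=> u v; apply: is_subgroupD (gspan_subgroup _).
move=> n _; apply: (@gspan_deg R sub_preGraded n); split; first exact: Sc.
exact: hcomp_deg.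
Qed.

(** Injectivity speaks of morphisms between graded modules, and [S] becomes one as the span of its
    homogeneous elements. Since [f] is a plain function whose laws matter only on [S], it can be
    defined by choice with dummy values elsewhere. *)
Lemma graded_injective_extend (E : gradedModule R) (f : N -> E) :
  graded_injective E ->
  (forall x y, S x -> S y -> f (x + y) = f x + f y) ->
  (forall a x, S x -> f (a *: x) = a *: f x) ->
  (forall n x, S x -> gmod_deg n x -> gmod_deg n (f x)) ->
  exists g : gradedHom N E, forall x, S x -> g x = f x.
Proof.
move=> Einj fD fZ fdeg.
pose M := gspan_module sub_preGraded.
have MS (x : M) : S (gspan_val x) by apply/sub_gspanP; exact: gspanP.
pose iv (x : M) : N := gspan_val x.
have iv_lin : linear iv by move=> a x y; rewrite /iv gspan_valD gspan_valZ.
pose ivL := GRing.isLinear.Build R M N *:%R iv iv_lin.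
pose ivl : {linear M -> N} := HB.pack iv ivL.
pose fv (x : M) : E := f (gspan_val x).
have fv_lin : linear fv.
  move=> a x y; rewrite /fv gspan_valD gspan_valZ fD ?fZ //.
  by have [[_ SZ] _] := Sg; exact: SZ.
pose fvL := GRing.isLinear.Build R M E *:%R fv fv_lin.
pose fvl : {linear M -> E} := HB.pack fv fvL.
have ivd n (x : M) : gmod_deg n x -> gmod_deg n (ivl x) by move=> [_].
have fvd n (x : M) : gmod_deg n x -> gmod_deg n (fvl x) by move=> [? ?]; exact: fdeg.
have [|g gE] := Einj M N (GradedHom ivd) (GradedHom fvd).
  by move=> x y /= xy; exact: val_inj.
exists g => x Sx.
have xin : x \in @gspan_pred R sub_preGraded by apply/asboolP/sub_gspanP.
exact: (gE (GSpan xin)).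
Qed.

End Sub.
End GradedSubmodules.

(** * Hilbert's basis theorem *)

Section Ascending.
Variable B : comNzRingType.
Implicit Types (Om U N : set B).

Definition stable Om N := is_subgroup N /\ forall w x, Om w -> N x -> N (w * x).

(** [Om] is a mere set of multipliers: taking ring generators for it expresses noetherianity of a
    submodule of [B] over a subring without constructing either. *)
Definition acc Om U := forall N : nat -> set B, (forall i, stable Om (N i)) ->
  (forall i, N i `<=` U) -> (forall i, N i `<=` N i.+1) ->
  exists i0, forall i, (i0 <= i)%N -> N i `<=` N i0.

Lemma chain_le (N : nat -> set B) : (forall i, N i `<=` N i.+1) ->
  forall i j, (i <= j)%N -> N i `<=` N j.
Proof.
move=> h i j; elim: j => [|j IH]; first by rewrite leqn0 => /eqP ->.
by rewrite leq_eqVlt => /predU1P[->//|/IH s] x /s; exact: h.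
Qed.

Lemma acc_sub Om Om' U U' : Om `<=` Om' -> U' `<=` U -> acc Om U -> acc Om' U'.
Proof.
move=> sO sU aU N hN NU; apply: aU => i; last by move=> x /NU /sU.
by have [? h] := hN i; split=> // w x /sO; exact: h.
Qed.

(** A member of the chain is controlled by its intersection with [U] and by its image modulo [U];
    the latter is read off from its representatives in [U']. *)
Lemma acc_sum Om U U' : stable Om U -> stable Om U' -> acc Om U -> acc Om U' ->
  acc Om [set z | exists2 x, U x & exists2 y, U' y & z = x + y].
Proof.
move=> [UG UO] [UG' UO'] aU aU' N hN NU ch.
pose K i : set B := [set x | U x /\ N i x].
pose L i : set B := [set y | U' y /\ exists2 x, U x & N i (x + y)].
have [i0 h0] : exists i0, forall i, (i0 <= i)%N -> K i `<=` K i0.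
  apply: aU => [i|i x []//|i x [Ux Nx]]; last by split=> //; exact: ch.
  have [NG NO] := hN i; split; last by move=> w x hw [Ux Nx]; split; [exact: UO|exact: NO].
  split=> [|x y [? ?] [? ?]]; first by split; exact: subgroup0.
  by split; exact: subgroupB.
have [i1 h1] : exists i1, forall i, (i1 <= i)%N -> L i `<=` L i1.
  apply: aU' => [i|i x []//|i y [Uy [x Ux Nxy]]]; last first.
    by split=> //; exists x => //; exact: ch.
  have [NG NO] := hN i; split; last first.
    move=> w y hw [Uy [x Ux Nxy]]; split; first exact: UO'.
    by exists (w * x); [exact: UO|rewrite -mulrDr; exact: NO].
  split=> [|y y' [Uy [x Ux Nxy]] [Uy' [x' Ux' Nxy']]].
    split; first exact: subgroup0.
    by exists 0; [exact: subgroup0|rewrite addr0; exact: subgroup0].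
  split; first exact: subgroupB.
  exists (x - x'); first exact: subgroupB.
  by rewrite addrACA -opprD; exact: subgroupB.
exists (maxn i0 i1) => i; rewrite geq_max => /andP[le0 le1] z Nz.
have [x Ux [y Uy zE]] := NU _ _ Nz.
have [_ [x' Ux' Nx']] : L i1 y by apply: (h1 i) => //; split=> //; exists x => //; rewrite -zE.
have Nm : N (maxn i0 i1) (x' + y) by apply: chain_le ch _ _ (leq_maxr _ _) _ Nx'.
have [_ Nd] : K i0 (x - x').
  apply: (h0 i) => //; split; first exact: subgroupB.
  rewrite (_ : x - x' = z - (x' + y)); last by rewrite zE opprD addrACA subrr addr0.
  have [NG _] := hN i; apply: subgroupB => //.
  exact: chain_le ch _ _ le1 _ Nx'.
rewrite (_ : z = (x - x') + (x' + y)); last by rewrite zE addrA subrK.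
have [NG _] := hN (maxn i0 i1); apply: is_subgroupD => //.
exact: chain_le ch _ _ (leq_maxl _ _) _ Nd.
Qed.

Lemma acc_mul Om U y : stable Om U -> acc Om U -> acc Om [set y * x | x in U].
Proof.
move=> [UG UO] aU N hN NU ch.
have [i0 h0] : exists i0, forall i, (i0 <= i)%N ->
    [set x | U x /\ N i (y * x)] `<=` [set x | U x /\ N i0 (y * x)].
  apply: (aU (fun i => [set x | U x /\ N i (y * x)]));
    [|by move=> i x []|by move=> i x [Ux /ch]].
  move=> i; have [NG NO] := hN i; split.
    split=> [|u v [Uu Nu] [Uv Nv]]; split; rewrite ?mulr0 ?mulrBr;
    by [apply: subgroup0|apply: subgroupB].
  move=> w x hw [Ux Nx]; split; first exact: UO.
  by rewrite mulrCA; exact: NO.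
by exists i0 => i /h0 h z Nz; have [x Ux xz] := NU _ _ Nz; subst z; have [] := h x.
Qed.

(* [U[x]] is studied through the leading coefficients, in [U], of its elements
   written, in any way, as polynomials in [x]. *)
Definition adjoin U (x : B) : set B :=
  [set z | exists2 p : {poly B}, forall k, U p`_k & z = p.[x]].

Definition lead_set U N x (k : nat) : set B := [set u | U u /\
  exists p : {poly B}, [/\ forall k, U p`_k, (size p <= k)%N & N (u * x ^+ k + p.[x])]].

Lemma lead_set_stable Om U N x k : stable Om U -> stable Om N ->
  stable Om (lead_set U N x k).
Proof.
move=> [UG UO] [NG NO]; split.
  split=> [|u v [Uu [p [Up sp Np]]] [Uv [q [Uq sq Nq]]]].
    split; first exact: subgroup0.
    exists 0; split=> [i||]; rewrite ?coef0 ?size_poly0 ?horner0 ?mul0r ?addr0 //;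
    exact: subgroup0.
  split; first exact: subgroupB.
  exists (p - q); split=> [i||].
  - by rewrite coefB; exact: subgroupB.
  - by rewrite (leq_trans (size_polyD _ _)) // geq_max sp size_polyN.
  - by rewrite mulrBl hornerD hornerN addrACA -opprD; exact: subgroupB.
move=> w u hw [Uu [p [Up sp Np]]]; split; first exact: UO.
exists (w *: p); split=> [i||].
- by rewrite coefZ; exact: UO.
- exact: leq_trans (size_scale_leq _ _) sp.
- by rewrite hornerZ -mulrA -mulrDr; exact: NO.
Qed.

Lemma lead_setS Om U N x k : stable (x |` Om) N ->
  lead_set U N x k `<=` lead_set U N x k.+1.
Proof.
move=> [NG NO] u [Uu [p [Up sp Np]]]; split=> //; exists (p * 'X); split.
- move=> i; rewrite coefMX; case: i => [|i] //=; have := Up (size p).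
  by rewrite nth_default.
- rewrite (leq_trans (size_polyMleq _ _)) // size_polyX addn2 /=; exact: sp.
- by rewrite hornerMX exprSr mulrA -mulrDl mulrC; apply: NO => //; left.
Qed.

(** Hilbert's argument: the leading sets [L i k] increase with both [i] and [k]. Stability of the
    diagonal settles all degrees from [d] on, and the finitely many degrees below [d] are settled
    one at a time. *)
Lemma acc_adjoin Om U x : stable Om U -> acc Om U -> acc (x |` Om) (adjoin U x).
Proof.
move=> stU aU N hN NU ch.
have hN' i : stable Om (N i).
  by have [NG NO] := hN i; split=> // w y hw; apply: NO; right.
pose L i k := lead_set U (N i) x k.
have LS i k : L i k `<=` L i k.+1 by exact: (lead_setS (hN i)).
have LN i k : L i k `<=` L i.+1 k.
  by move=> u [Uu [p [Up sp Np]]]; split=> //; exists p; split=> //; exact: ch.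
have Lst i k : stable Om (L i k) by exact: lead_set_stable.
have LU i k : L i k `<=` U by move=> u [].
have Lle i j k l : (i <= j)%N -> (k <= l)%N -> L i k `<=` L j l.
  move=> ij kl u /(chain_le (LS i) kl); exact: (chain_le (fun i => @LN i l) ij).
have [d hd] : exists d, forall i, (d <= i)%N -> L i i `<=` L d d.
  by apply: aU => // i u /LS /LN.
have : exists m, forall i k, (m <= i)%N -> (k < d)%N -> L i k `<=` L m k.
  elim: (d) => [|e [m hm]]; first by exists 0%N.
  have [m' hm'] : exists m, forall i, (m <= i)%N -> L i e `<=` L m e.
    by apply: aU => // i; exact: LN.
  exists (maxn m m') => i k; rewrite geq_max => /andP[mi m'i].
  rewrite ltnS leq_eqVlt => /predU1P[->|ke] u hu.
    by apply: (Lle m' _ e) (hm' i m'i u hu); rewrite ?leq_maxr.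
  by apply: (Lle m _ k) (hm i k mi ke u hu); rewrite ?leq_maxl.
move=> [m hm]; exists (maxn d m) => i; rewrite geq_max => /andP[di mi] z.
have Lim k : L i k `<=` L (maxn d m) k.
  have [kd|dk] := ltnP k d.
    by move=> u /(hm i k mi kd); apply: Lle; rewrite ?leq_maxr.
  move=> u hu; apply: (Lle d _ d); rewrite ?leq_maxl //.
  by apply: (hd (maxn i k)); [rewrite leq_max di|apply: Lle hu; rewrite ?leq_maxl ?leq_maxr].
have [NG _] := hN (maxn d m); have [NGi _] := hN i.
have le : (maxn d m <= i)%N by rewrite geq_max di mi.
have UG := stU.1.
(* Subtracting an element of the stable member with the same leading coefficient lowers the formal
   degree. *)
suff rec n : forall p : {poly B}, (size p <= n)%N -> (forall k, U p`_k) ->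
    N i p.[x] -> N (maxn d m) p.[x].
  by move=> Nz; have [p Up zE] := NU _ _ Nz; rewrite zE in Nz *; exact: (rec (size p)).
elim: n => [|n IH] p sp Up Np.
  by move: sp; rewrite leqn0 size_poly_eq0 => /eqP ->; rewrite horner0; exact: subgroup0.
pose q := \poly_(k < n) p`_k.
have pE : p = p`_n *: 'X^n + q.
  apply/polyP => k; rewrite coefD coefZ coefXn coef_poly.
  have [->|kn] := eqVneq k n; first by rewrite ltnn mulr1 addr0.
  rewrite mulr0 add0r; case: ltnP => // nk.
  by rewrite nth_default // (leq_trans sp) // ltn_neqAle eq_sym kn.
have pxE : p.[x] = p`_n * x ^+ n + q.[x] by rewrite {1}pE hornerD hornerZ hornerXn.
have [_ [r [Ur sr Nr]]] : L (maxn d m) n p`_n.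
  apply: Lim; split=> //; exists q; rewrite -pxE; split=> //; last exact: size_poly.
  by move=> k; rewrite coef_poly; case: ifP => _ //; exact: subgroup0.
have -> : p.[x] = (p`_n * x ^+ n + r.[x]) + (q - r).[x].
  by rewrite pxE hornerD hornerN -addrA (addrC r.[x]) subrK.
apply: is_subgroupD => //; apply: IH.
- by rewrite (leq_trans (size_polyD _ _)) // geq_max size_poly size_polyN.
- move=> k; rewrite coefB coef_poly; apply: subgroupB => //.
  by case: ifP => _ //; exact: subgroup0.
- have -> : (q - r).[x] = p.[x] - (p`_n * x ^+ n + r.[x]).
    by rewrite pxE hornerD hornerN opprD addrACA subrr add0r.
  apply: subgroupB => //; exact: chain_le ch _ _ le _ Nr.
Qed.

Lemma adjoin_sub U x : is_subgroup U -> U `<=` adjoin U x.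
Proof.
move=> UG u Uu; exists u%:P; last by rewrite hornerC.
by move=> k; rewrite coefC; case: ifP => // _; exact: subgroup0.
Qed.

Definition is_subring U := is_subgroup U /\ (U 1 /\ forall x y, U x -> U y -> U (x * y)).

Lemma adjoin_subring U x : is_subring U -> is_subring (adjoin U x) /\ adjoin U x x.
Proof.
move=> [UG [U1 UM]]; have U0 := subgroup0 UG; split; last first.
  exists 'X; last by rewrite hornerX.
  by move=> k; rewrite coefX; case: eqP.
split; last split.
- split; first by exists 0 => [k|]; rewrite ?coef0 ?horner0.
  move=> _ _ [p Up ->] [q Uq ->]; exists (p - q); last by rewrite hornerD hornerN.
  by move=> k; rewrite coefB; exact: subgroupB.
- exact: adjoin_sub.
- move=> _ _ [p Up ->] [q Uq ->]; exists (p * q); last by rewrite hornerM.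
  by move=> k; rewrite coefM; apply: subgroup_sum => // i _; exact: UM.
Qed.

Lemma adjoin_stable Om U x : stable Om U -> is_subring U -> stable (x |` Om) (adjoin U x).
Proof.
move=> [_ UO] UR; have [[AG [A1 AM]] Ax] := adjoin_subring x UR.
split=> // w z [->|hw] hz; first exact: AM.
have [p Up ->] := hz; exists (w *: p); last by rewrite hornerZ.
by move=> k; rewrite coefZ; exact: UO.
Qed.

Lemma acc_adjoin_seq Om U (s : seq B) : stable Om U -> is_subring U -> acc Om U ->
  exists W, [/\ is_subring W, acc (Om `|` [set` s]) W, U `<=` W & [set` s] `<=` W].
Proof.
move=> stU UR aU.
suff [W [WR Wa UW sW _]] : exists W, [/\ is_subring W, acc (Om `|` [set` s]) W,
    U `<=` W, [set` s] `<=` W & stable (Om `|` [set` s]) W] by exists W.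
elim: s => [|x s [W [WR Wa UW sW stW]]].
  exists U; split=> //; first by apply: acc_sub aU => // w; left.
  by case: stU => UG UO; split=> // w y [/UO|//]; apply.
have [AR Ax] := adjoin_subring x WR.
have sub : x |` (Om `|` [set` s]) = Om `|` [set` x :: s].
  apply/seteqP; split=> w /=; rewrite inE.
    by move=> [->|[?|ws]]; [right; rewrite eqxx|left|right; rewrite ws orbT].
  by move=> [?|/predU1P[->|ws]]; [right; left|left|right; right].
exists (adjoin W x); split=> //.
- by rewrite -sub; exact: acc_adjoin.
- by move=> u /UW; apply: adjoin_sub; case: WR.
- move=> w /=; rewrite inE => /predU1P[->//|ws]; apply: adjoin_sub; first by case: WR.
  exact: sW.
- by rewrite -sub; exact: adjoin_stable.
Qed.

(* [U + U y + ... + U y^m] is a ring as soon as it contains [y^(m+1)]. *)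
Lemma acc_integral Om U y m : stable Om U -> is_subring U -> acc Om U ->
    (exists p : {poly B}, [/\ forall k, U p`_k, (size p <= m.+1)%N & y ^+ m.+1 = p.[y]]) ->
  exists W, [/\ is_subring W, stable Om W, acc Om W, U `<=` W & W y].
Proof.
move=> [UG UO] UR aU [p [Up sp yE]]; have [_ [U1 UM]] := UR.
have U0 := subgroup0 UG.
(* The Horner form makes [accW] an induction with [acc_sum] and [acc_mul]; [WP] recovers the
   description by polynomials of size at most [k]. *)
pose fix W (k : nat) : set B := if k is k'.+1 then
  [set z | exists2 b, U b & exists2 u, [set y * u | u in W k'] u & z = b + u] else [set 0].
have WP k z : W k z <-> exists q : {poly B},
    [/\ forall k, U q`_k, (size q <= k)%N & z = q.[y]].
  elim: k z => [|k IH] z; split.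
  - by move=> ->; exists 0; split=> [k||]; rewrite ?coef0 ?size_poly0 ?horner0.
  - by move=> [q [_ + ->]]; rewrite leqn0 size_poly_eq0 => /eqP ->; rewrite horner0.
  - move=> [b Ub [_ [u /IH[q [Uq sq ->]] <-] ->]]; exists (q * 'X + b%:P); split.
    + move=> i; rewrite coefD coefMX coefC; case: i => [|i]; rewrite ?add0r ?addr0 //=.
    + by rewrite -cons_poly_def size_cons_poly; case: ifP.
    + by rewrite hornerD hornerMX hornerC addrC mulrC.
  - move=> [q [Uq sq ->]]; have [b [r rE]] : exists b, exists r, q = r * 'X + b%:P.
      by elim/poly_ind: (q) => [|r b _]; [exists 0, 0; rewrite mul0r addr0|exists b, r].
    have bE : b = q`_0 by rewrite rE coefD coefMX coefC add0r.
    have rk i : r`_i = q`_i.+1 by rewrite rE coefD coefMX coefC addr0.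
    exists b; first by rewrite bE.
    exists (y * r.[y]); last by rewrite rE hornerD hornerMX hornerC addrC mulrC.
    exists r.[y] => //; apply/IH; exists r; split=> // [i|]; first by rewrite rk.
    by apply/leq_sizeP => i ki; rewrite rk nth_default // (leq_trans sq).
have stW k : stable Om (W k).
  split.
    split; first by apply/WP; exists 0; split=> [i||]; rewrite ?coef0 ?size_poly0 ?horner0.
    move=> _ _ /WP[q [Uq sq ->]] /WP[r [Ur sr ->]]; apply/WP; exists (q - r).
    split; last by rewrite hornerD hornerN.
      by move=> i; rewrite coefB; exact: subgroupB.
    by rewrite (leq_trans (size_polyD _ _)) // geq_max sq size_polyN.
  move=> w _ hw /WP[q [Uq sq ->]]; apply/WP; exists (w *: q); split.
  - by move=> i; rewrite coefZ; exact: UO.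
  - exact: leq_trans (size_scale_leq _ _) sq.
  - by rewrite hornerZ.
have stY k : stable Om [set y * u | u in W k].
  have [WG WO] := stW k; split.
    split; first by exists 0; rewrite ?mulr0 //; exact: subgroup0.
    by move=> _ _ [u Wu <-] [v Wv <-]; exists (u - v); rewrite ?mulrBr //; exact: subgroupB.
  by move=> w _ hw [u Wu <-]; exists (w * u); rewrite ?(mulrCA w) //; exact: WO.
have accW k : acc Om (W k).
  elim: k => [|k IH]; last by apply: acc_sum => //; exact: acc_mul.
  move=> N hN N0 _; exists 0%N => i _ z /N0 ->.
  by have [NG _] := hN 0%N; exact: subgroup0.
have WU k u v : U u -> W k v -> W k (u * v).
  move=> Uu /WP[q [Uq sq ->]]; apply/WP; exists (u *: q); split; last by rewrite hornerZ.
    by move=> i; rewrite coefZ; exact: UM.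
  exact: leq_trans (size_scale_leq _ _) sq.
have WG := (stW m.+1).1.
(* Only the power [y ^+ m.+1] leaves the allowed range, and [yE] brings it back. *)
have Wy v : W m.+1 v -> W m.+1 (y * v).
  move=> /WP[q [Uq sq ->]].
  pose r := \poly_(k < m) q`_k.
  have qE : q = q`_m *: 'X^m + r.
    apply/polyP => k; rewrite coefD coefZ coefXn coef_poly.
    have [->|kn] := eqVneq k m; first by rewrite ltnn mulr1 addr0.
    rewrite mulr0 add0r; case: ltnP => // nk.
    by rewrite nth_default // (leq_trans sq) // ltn_neqAle eq_sym kn.
  have -> : y * q.[y] = q`_m * y ^+ m.+1 + (r * 'X).[y].
    by rewrite {1}qE hornerD hornerZ hornerXn hornerMX mulrDr exprS mulrCA (mulrC y r.[y]).
  apply: is_subgroupD => //; first by rewrite yE; apply: WU => //; apply/WP; exists p.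
  apply/WP; exists (r * 'X); split=> // [i|].
    by rewrite coefMX coef_poly; do 2!case: ifP => _ //.
  by rewrite (leq_trans (size_polyMleq _ _)) // size_polyX addn2 ltnS size_poly.
have U_W : U `<=` W m.+1.
  move=> u Uu; apply/WP; exists u%:P; split; last by rewrite hornerC.
    by move=> k; rewrite coefC; case: ifP.
  by rewrite (leq_trans (size_polyC_leq1 _)).
exists (W m.+1); split=> //; last by rewrite -(mulr1 y); apply/Wy/U_W.
split=> //; split; first exact: U_W.
suff h k u v : W k u -> W m.+1 v -> W m.+1 (u * v) by move=> u v; exact: (h m.+1).
elim: k u => [|k IH] u; first by move=> -> _; rewrite mul0r; exact: subgroup0.
move=> [b Ub [_ [u' Wu' <-] ->]] Wv; rewrite mulrDl; apply: is_subgroupD => //.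
  exact: WU.
by rewrite -mulrA; apply: Wy; exact: IH.
Qed.

End Ascending.

(** * Noetherianity of A[It] and of R(F) *)

Section Noetherian.
Variable A : comNzRingType.
Implicit Types (I J K : set A).

Lemma ideal_subgroup J : is_ideal J -> is_subgroup J.
Proof.
move=> [J0 JD JM]; split=> // x y hx hy.
by apply: JD => //; rewrite -mulN1r; exact: JM.
Qed.

Lemma noetherian_chain (noethA : noetherian A) (J : nat -> set A) :
  (forall i, is_ideal (J i)) -> (forall i, J i `<=` J i.+1) ->
  exists i0, forall i, (i0 <= i)%N -> J i `<=` J i0.
Proof.
move=> Ji ch; pose K := [set x | exists i, J i x].
have le := chain_le (B := A) ch.
have idK : is_ideal K.
  split; first by exists 0%N; case: (Ji 0%N).
    move=> x y [i xi] [j yj]; exists (maxn i j); have [_ JD _] := Ji (maxn i j).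
    by apply: JD; [exact: le (leq_maxl _ _) _ xi|exact: le (leq_maxr _ _) _ yj].
  by move=> a x [i xi]; exists i; have [_ _ JM] := Ji i; exact: JM.
have [s KE] := noethA _ idK.
have sK : [set` s] `<=` K by rewrite KE; exact: sub_gen_smallest.
suff [i0 h0] : exists i0, [set` s] `<=` J i0.
  exists i0 => i _ x xi; have : K x by exists i.
  by rewrite KE; apply.
clear KE; elim: s sK => [|x s IH] sK; first by exists 0%N.
have [i hi] := IH (fun y ys => sK y (mem_behead (s := x :: s) ys)).
have [j hj] := sK x (mem_head _ _).
exists (maxn i j) => y /=; rewrite inE => /predU1P[->|ys].
  exact: le (leq_maxr _ _) _ hj.
exact: le (leq_maxl _ _) _ (hi y ys).
Qed.

Definition constants : set {poly A} := [set p | exists a, p = a%:P].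

Lemma constants_subring : is_subring constants.
Proof.
split; last split.
- split; first by exists 0; rewrite polyC0.
  by move=> _ _ [a ->] [b ->]; exists (a - b); rewrite polyCB.
- by exists 1; rewrite polyC1.
- by move=> _ _ [a ->] [b ->]; exists (a * b); rewrite polyCM.
Qed.

Lemma constants_stable : stable constants constants.
Proof. by have [? [_ ?]] := constants_subring; split. Qed.

Lemma acc_constants : noetherian A -> acc constants constants.
Proof.
move=> noethA N hN NU ch; pose J i := [set a : A | N i a%:P].
have [||i0 h0] := @noetherian_chain noethA J.
- move=> i; have [NG NO] := hN i; split; rewrite /J /=.
  + by rewrite polyC0; exact: subgroup0.
  + by move=> x y hx hy; rewrite /= polyCD; exact: is_subgroupD.
  + by move=> a x hx /=; rewrite polyCM; apply: NO => //; exists a.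
- by move=> i a; exact: ch.
by exists i0 => i ii x Nx; have [a xE] := NU _ _ Nx; subst x; exact: h0 i ii a Nx.
Qed.

(* Generators of A[It] as a ring when s generates I: [stable (rees_ops s)] means
   A[It]-submodule of A[t]. *)
Definition rees_ops (s : seq A) : set {poly A} :=
  constants `|` [set` [seq a *: 'X | a <- s]].

Lemma subring_monomials I (s : seq A) (W : set {poly A}) :
  I = ideal_gen [set` s] -> is_subring W -> rees_ops s `<=` W ->
  rees_set (adic I) `<=` W.
Proof.
move=> IE [WG [W1 WM]] sW p hp.
have cW a : W a%:P by apply: sW; left; exists a.
have id n : is_ideal [set a | W (a *: 'X^n)].
  split=> /= [|x y hx hy|a x hx]; first by rewrite scale0r; exact: subgroup0.
    by rewrite scalerDl; exact: is_subgroupD.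
  by rewrite -scalerA -mul_polyC; exact: WM.
have I1 : I `<=` [set a | W (a *: 'X^1)].
  rewrite IE; apply: smallest_sub => // a h; apply: sW; right; apply/mapP.
  by exists a => //; rewrite expr1.
have In n : ideal_exp I n `<=` [set a | W (a *: 'X^n)].
  elim: n => [|n IH]; first by move=> a _ /=; rewrite expr0 alg_polyC.
  apply: smallest_sub => // _ [x [y [Ix Iy ->]]] /=.
  have -> : (x * y) *: 'X^(n.+1) = (x *: 'X^1) * (y *: 'X^n) :> {poly A}.
    by rewrite -scalerAr -scalerAl scalerA mulrC exprS expr1.
  by apply: WM; [exact: I1|exact: IH].
rewrite -[p]coefK poly_def; apply: subgroup_sum => // i _.
exact: In (hp i).
Qed.

Lemma rees_subringW (F : multFiltration A) : is_subring (rees_set F).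
Proof.
have [h1 hB hM] := rees_subring F.
have W p : rees_set F p -> p \in rees_pred F by move=> ?; apply/asboolP.
split; last split.
- split=> [n|p q /W hp /W hq]; last exact/asboolP/hB.
  by rewrite coef0; have [] := filt_ideal F n.
- exact/asboolP.
- by move=> p q /W hp /W hq; apply/asboolP/hM.
Qed.

Lemma acc_rees_adic I (s : seq A) : noetherian A -> I = ideal_gen [set` s] ->
  acc (rees_ops s) (rees_set (adic I)).
Proof.
move=> noethA IE.
have [W [WR Wa cW sW]] := @acc_adjoin_seq _ constants constants
  [seq a *: 'X | a <- s] constants_stable constants_subring (acc_constants noethA).
apply: acc_sub Wa => //; apply: subring_monomials IE WR _.
by move=> p [/cW|/sW].
Qed.

Lemma ideal_exp_sub I m n : (n <= m)%N -> ideal_exp I m `<=` ideal_exp I n.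
Proof.
elim: m => [|m IH]; first by rewrite leqn0 => /eqP ->.
rewrite leq_eqVlt => /predU1P[->//|]; rewrite ltnS => /IH h x /ideal_expS_sub; exact: h.
Qed.

Lemma ideal_exp_expn I n i : ideal_exp (ideal_exp I n) i `<=` ideal_exp I (i * n).
Proof.
elim: i => [|i IH]; first by [].
apply: smallest_sub; first exact: ideal_exp_ideal.
move=> _ [x [y [hx /IH hy ->]]]; rewrite mulSn; apply: ideal_exp_mul.
by apply: sub_gen_smallest; exists x, y.
Qed.

Lemma rees_ops_sub I (s : seq A) : I = ideal_gen [set` s] ->
  rees_ops s `<=` rees_set (adic I).
Proof.
move=> IE p [[a ->]|/mapP[a sa ->]] n /=.
  rewrite coefC; case: eqP => [->//|_]; by have [] := ideal_exp_ideal I n.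
rewrite coefZ coefX; case: eqP => [->|_]; last by rewrite mulr0; have [] := ideal_exp_ideal I n.
rewrite mulr1 /=; apply: sub_gen_smallest; exists a, 1; split; rewrite ?mulr1 //.
by rewrite IE; exact: sub_gen_smallest.
Qed.

(** The monomials of the finitely many generators of R(F) are integral over A[It]. Adjoining them
    one by one produces a noetherian A[It]-module that contains R(F). *)
Lemma acc_rees I (s : seq A) (F : multFiltration A) :
    noetherian A -> I = ideal_gen [set` s] -> rees_finitely_generated F ->
    (forall n : nat, (1 <= n)%N -> F n `<=` integral_closure (ideal_exp I n)) ->
  acc (rees_ops s) (rees_set F).
Proof.
move=> noethA IE [S FE] int.
pose R := rees_set (adic I); have RR : is_subring R := rees_subringW _.
have Rst : stable (rees_ops s) R.
  split; first by case: RR.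
  move=> w x /(rees_ops_sub IE) hw hx; case: RR => _ [_]; exact.
have Ra := acc_rees_adic noethA IE.
pose ms := [seq p`_k *: 'X^k | p : {poly A} <- S, k : nat <- iota 0 (size p)].
have SF : [set` S] `<=` rees_set F by rewrite FE; exact: sub_gen_smallest.
have msint y : y \in ms -> exists m (p : {poly {poly A}}),
    [/\ forall k, R p`_k, (size p <= m.+1)%N & y ^+ m.+1 = p.[y]].
  move=> /allpairsPdep[p [k [pS kp ->]]].
  have Fk : F k p`_k by exact: SF pS k.
  (* The hypothesis [int] starts in degree 1; a monomial of degree 0 is a constant, hence already in
     A[It]. *)
  case: k {kp} Fk => [|k] Fk.
    exists 0%N, (p`_0)%:P%:P; split.
    - move=> i; rewrite coefC; case: eqP => [_|_]; last exact: subgroup0 RR.1.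
      by apply: (rees_ops_sub IE); left; exists p`_0.
    - exact: size_polyC_leq1.
    - by rewrite expr0 alg_polyC hornerC expr1.
  have [n [a [n0 ha eq0]]] := int k.+1 isT _ Fk.
  set c := p`_k.+1 in eq0 *.
  case: n n0 ha eq0 => // n _ ha eq0.
  (* The integral equation of [c], made homogeneous: its i-th coefficient lies in I^(i(k+1)), so
     giving it degree i(k+1) puts it in A[It]. *)
  pose q := \poly_(i < n.+1) (- (a (n.+1 - i)%N) *: 'X^((n.+1 - i) * k.+1) : {poly A}).
  exists n, q; split; last 1 first.
  - rewrite horner_poly exprZn -exprM.
    move/eqP: eq0; rewrite addr_eq0 => /eqP ->.
    rewrite big_add1 /= big_mkord -sumrN scaler_suml (reindex_inj rev_ord_inj) /=.
    apply: eq_bigr => i _; rewrite subnSK // subKn ?(leq_trans (leq_subr _ _)) //;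
      last by rewrite ltnW.
    rewrite exprZn -exprM -scalerAl -scalerAr scalerA -exprD mulNr.
    by rewrite (mulnC (n.+1 - i)%N) -mulnDr subnK // ltnW.
  - move=> i; rewrite coef_poly; case: ifP => ii; last exact: subgroup0 RR.1.
    move=> j; rewrite coefZ coefXn; case: eqP => [->|_]; last first.
      by rewrite mulr0; have [] := ideal_exp_ideal I j.
    rewrite mulr1; apply: filtN; apply: ideal_exp_expn; apply: ha.
    by rewrite subn_gt0 ii leq_subr.
  - exact: size_poly.
suff [W [WR _ Wa RW msW]] : exists W, [/\ is_subring W, stable (rees_ops s) W,
    acc (rees_ops s) W, R `<=` W & [set` ms] `<=` W].
  apply: acc_sub Wa => //; rewrite FE; apply: smallest_sub.
    have [WG [W1 WM]] := WR; split=> //.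
      by move=> a; apply/RW/(rees_ops_sub IE); left; exists a.
    by move=> p q; exact: is_subgroupD.
  move=> p pS; have WG := WR.1; rewrite -[p]coefK poly_def; apply: subgroup_sum => // i _.
  apply: msW; apply/allpairsPdep; exists p, (nat_of_ord i); split=> //.
  by rewrite mem_iota add0n ltn_ord.
elim: ms msint => [|y ms IH] msint; first by exists R; split.
have [|W [WR Wst Wa RW msW]] := IH; first by move=> z zm; apply: msint; rewrite inE zm orbT.
have [m [p [Rp sp yE]]] := msint y (mem_head _ _).
have [|W' [WR' Wst' Wa' WW' W'y]] := @acc_integral _ _ W y m Wst WR Wa.
  by exists p; split=> // k; apply: RW.
exists W'; split=> //; first by move=> x /RW /WW'.
by move=> z /=; rewrite inE => /predU1P[->//|/msW /WW'].
Qed.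

End Noetherian.

(** * Koszul complexes and torsion in graded injective modules *)

Definition ideal_acc (R : comNzRingType) := forall J : nat -> set R,
  (forall i, is_ideal (J i)) -> (forall i, J i `<=` J i.+1) ->
  exists i0, forall i, (i0 <= i)%N -> J i `<=` J i0.

Section Divide.
Variable R : gradedRing.

Lemma gring_degX d (x : R) k : gring_deg d x -> gring_deg (d * k%:Z) (x ^+ k).
Proof.
move=> dx; elim: k => [|k IH]; first by rewrite mulr0 expr0; exact: gring1.
by rewrite exprS intS mulrDr mulr1; exact: gringM.
Qed.

Variable a : int.

Let rdeg (n : int) : set R^o := [set r : R^o | gring_deg (n - a) (r : R)].

Lemma ring_shift_grading : is_grading rdeg.
Proof. exact: (grading_shift a (gring_grading R)). Qed.

Lemma ring_shift_degZ m n (r : R) (x : R^o) :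
  gring_deg m r -> rdeg n x -> rdeg (m + n) (r *: x).
Proof. by move=> hr hx; rewrite /rdeg /= -addrA; exact: gringM. Qed.

(** The twist R(-a): its generator 1 sits in degree [a], so that its graded homomorphisms to a
    module pick elements of degree [a]. *)
Definition ring_shift : gradedModule R := GradedModule ring_shift_grading ring_shift_degZ.

End Divide.

(* For k such that the annihilators of x^k v and x^(k+1) v agree, b + x^(k+1) r
   |-> x^k r v is well defined on ann v + x^(k+1) R; u is the value at 1 of an
   extension of this map to R. *)
Lemma graded_injective_divide (R : gradedRing) (E : gradedModule R) (x : R)
    (d m : int) (v : E) :
    ideal_acc R -> graded_injective E -> gring_deg d x -> gmod_deg m v ->
  exists u k, [/\ gmod_deg (m - d) u, x ^+ k.+1 *: u = x ^+ k *: v &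
    forall r : R, r *: v = 0 -> r *: u = 0].
Proof.
move=> accR Einj dx dv.
have [|i|k hk] := accR (fun k => [set r | r *: (x ^+ k *: v) = 0]).
- move=> i; split=> [|r s hr hs|r s hs] /=; first by rewrite scale0r.
    by rewrite scalerDl hr hs addr0.
  by rewrite -scalerA hs scaler0.
- by move=> r /= h; rewrite exprS -scalerA scalerA mulrC -scalerA h scaler0.
pose N := ring_shift R (m - d).
(* Acting on [v], of degree [m], is homogeneous of degree [d] from the twist by [m - d]; hence the
   annihilator of [v], and with it [S], is graded. *)
have Nc n (b : N) : hcomp (gmod_grading E) (n + d) ((b : R) *: v) =
    (hcomp (gmod_grading N) n b : R) *: v.
  elim/(grading_ind (gmod_grading N)): b => [|b c hb hc|l b hb].
  - by rewrite scale0r !hcomp0 scale0r.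
  - by rewrite scalerDl !hcompD hb hc scalerDl.
  - have dbv : gmod_deg (l + d) ((b : R) *: v).
      rewrite (_ : l + d = (l - (m - d)) + m); first exact: gmodZ.
      by rewrite opprB addrA subrK.
    have [->|/eqP ln] := eqVneq n l; first by rewrite !hcomp_id.
    have nl : l <> n by exact/nesym.
    have nl' : l + d <> n + d by move/addIr.
    by rewrite (hcomp_neq _ hb nl) (hcomp_neq _ dbv nl') scale0r.
pose S : set N := [set s | exists b r : R, b *: v = 0 /\ s = b + x ^+ k.+1 * r].
have Sg : graded_submodule S.
  split; first split.
  - split; first by exists 0, 0; rewrite scale0r mulr0 addr0.
    move=> _ _ [b [r [hb ->]]] [c [s [hc ->]]]; exists (b - c), (r - s).
    by rewrite scalerBl hb hc subr0 mulrBr opprD addrACA.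
  - move=> t _ [b [r [hb ->]]]; exists (t * b), (t * r).
    by rewrite -scalerA hb scaler0; split=> //; rewrite [LHS]mulrDr mulrCA.
  - move=> n _ [b [r [hb ->]]].
    exists (hcomp (gmod_grading N) n b), (hcomp (gmod_grading N) (n - d * k.+1%:Z) r).
    split; first by rewrite -Nc hb hcomp0.
    rewrite [LHS]hcompD; congr (_ + _).
    by rewrite -[n in LHS](subrKC (d * k.+1%:Z)) (hcompZ _ _ (gring_degX k.+1 dx)).
pose f (s : N) : E := match pselect (exists r : R, (s - x ^+ k.+1 * r : R) *: v = 0) with
  | left h => (x ^+ k * projT1 (cid h)) *: v | right _ => 0 end.
(* Two choices of [r] differ by an element that kills [x ^+ k.+1 *: v], hence also [x ^+ k *: v]. *)
have fE b r : b *: v = 0 -> f (b + x ^+ k.+1 * r) = (x ^+ k * r) *: v.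
  move=> hb; rewrite /f; case: pselect => [h|]; last first.
    by case; exists r; rewrite addrK.
  case: cid => r' /= hr'; apply/eqP; rewrite -subr_eq0 -scalerBl -mulrBr mulrC -scalerA.
  apply/eqP/(hk k.+1) => //=.
  rewrite scalerA; move: hr'.
  rewrite -addrA -mulrBr scalerDl hb add0r mulrC => /eqP.
  by rewrite -(opprB r' r) mulNr scaleNr oppr_eq0 => /eqP.
have [|t s|n s|g gE] := @graded_injective_extend R N S Sg E f Einj.
- move=> _ _ [b [r [hb ->]]] [c [s [hc ->]]].
  transitivity (f (b + c + x ^+ k.+1 * (r + s))).
    by congr f; rewrite [RHS]/= mulrDr; exact: addrACA.
  by rewrite !fE ?scalerDl ?hb ?hc ?addr0 // mulrDr scalerDl.
- move=> [b [r [hb ->]]].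
  transitivity (f (t * b + x ^+ k.+1 * (t * r))).
    by congr f; rewrite mulrCA -mulrDr.
  by rewrite !fE -?scalerA ?hb ?scaler0 // scalerA mulrC -scalerA.
- move=> [b [r [hb ->]]] /(hcomp_id (gmod_grading N)) <-.
  rewrite hcompD -[n in X in _ + X](subrKC (d * k.+1%:Z)).
  rewrite (hcompZ _ _ (gring_degX k.+1 dx)) fE; last by rewrite -Nc hb hcomp0.
  set n' := n - _; have dn' := hcomp_deg (gmod_grading N) n' r.
  rewrite (_ : n = d * k%:Z + (n' - (m - d)) + m); last first.
    by rewrite /n' intS; ring.
  by apply: gmodZ => //; apply: gringM => //; exact: gring_degX.
have gS b r : b *: v = 0 -> g (b + x ^+ k.+1 * r) = (x ^+ k * r) *: v.
  by move=> hb; rewrite gE ?fE //; exists b, r.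
exists (g (1 : R)), k; split.
- apply: ghom_deg; suff : gring_deg (m - d - (m - d)) (1 : R) by [].
  by rewrite subrr; exact: gring1.
- rewrite -linearZ /=; transitivity (g (0 + x ^+ k.+1 * 1)).
    by congr (g _); rewrite add0r.
  by rewrite gS ?mulr1 ?scale0r.
- move=> r hr; rewrite -linearZ /=; transitivity (g (r + x ^+ k.+1 * 0)).
    by congr (g _); rewrite mulr0 addr0; exact: mulr1.
  by rewrite gS // mulr0 scale0r.
Qed.

Notation weight := (count id).

Section Koszul.
Variables (R : comNzRingType) (V : lmodType R).
Implicit Types (xs : seq R) (c b : seq bool -> V) (s t : seq bool).

(* The Koszul differential.  A cochain of degree j is a function whose values
   matter only at the bit sequences of length [size xs] and weight j, which
   stand for the subsets of [xs] with j elements. *)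
Fixpoint koszul xs c s {struct xs} : V :=
  match xs, s with
  | x :: xs', e :: s' => if e then
      x *: c (false :: s') - koszul xs' (fun t => c (true :: t)) s'
    else koszul xs' (fun t => c (false :: t)) s'
  | _, _ => 0
  end.

(** The value at [s] is a signed sum of terms [x *: c t], with [t] obtained by removing one element
    of [s]. This spares the signs wherever only closure matters. *)
Lemma koszul_mem (P : set V) xs c s : is_subgroup P ->
  (forall x t, x \in xs -> size t = size s -> (weight t).+1 = weight s -> P (x *: c t)) ->
  P (koszul xs c s).
Proof.
move=> PG; elim: xs c s => [|x xs IH] c [|[] s] h /=; try exact: subgroup0.
  apply: subgroupB => //; first by apply: h; rewrite ?mem_head.
  apply: IH => y t yx st wt; apply: h; rewrite ?inE ?yx ?orbT //= ?st //.
  by rewrite -wt.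
apply: IH => y t yx st wt; apply: h; rewrite ?inE ?yx ?orbT //= ?st //.
Qed.

Lemma koszulB xs c b s :
  koszul xs (fun t => c t - b t) s = koszul xs c s - koszul xs b s.
Proof.
elim: xs c b s => [|x xs IH] c b [|[] s] /=; rewrite ?subr0 ?IH //.
by rewrite scalerBr !opprB [LHS]addrACA [RHS]addrACA; congr (_ + _); exact: addrC.
Qed.

Lemma koszul0 xs s : koszul xs (fun=> 0) s = 0.
Proof.
by elim: xs s => [|x xs IH] [|[] s] //=; rewrite IH ?scaler0 ?subr0.
Qed.

Lemma koszul_eq xs c b s :
  (forall t, size t = size s -> (weight t).+1 = weight s -> c t = b t) ->
  koszul xs c s = koszul xs b s.
Proof.
move=> h; apply/eqP; rewrite -subr_eq0 -koszulB; apply/eqP.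
apply: (@koszul_mem [set 0]); first by split=> // _ _ -> ->; rewrite subr0.
by move=> x t _ st wt; rewrite h // subrr scaler0.
Qed.

Lemma koszulZ xs (a : R) c s : koszul xs (fun t => a *: c t) s = a *: koszul xs c s.
Proof.
elim: xs c s => [|x xs IH] c [|[] s] /=; rewrite ?scaler0 ?IH //.
by rewrite scalerBr !scalerA mulrC.
Qed.

Lemma koszul_koszul xs c s : koszul xs (koszul xs c) s = 0.
Proof.
elim: xs c s => [|x xs IH] c [|[] s] //=.
have -> : koszul xs (fun t => koszul (x :: xs) c (true :: t)) s =
    x *: koszul xs (fun t => c (false :: t)) s.
  by rewrite [LHS]koszulB koszulZ IH subr0.
by rewrite subrr.
Qed.

Lemma koszulD xs c b s :
  koszul xs (fun t => c t + b t) s = koszul xs c s + koszul xs b s.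
Proof.
have -> : (fun t => c t + b t) = (fun t => c t - (0 - b t)).
  by apply/funext => t; rewrite sub0r opprK.
by rewrite !koszulB koszul0 sub0r opprK.
Qed.

(** Interior product with the i-th basis vector: by [koszul_contraction] it is a homotopy between
    multiplication by the i-th entry of [xs] and 0, so each entry annihilates Koszul cohomology. *)
Fixpoint contraction (i : nat) c s {struct s} : V :=
  match i, s with
  | 0%N, e :: s' => if e then 0 else c (true :: s')
  | i'.+1, e :: s' => let h := contraction i' (fun t => c (e :: t)) s' in
    if e then - h else h
  | _, _ => 0
  end.

Lemma contraction_mem (P : set V) i c s : is_subgroup P ->
  (forall t, size t = size s -> weight t = (weight s).+1 -> P (c t)) ->
  P (contraction i c s).
Proof.
move=> PG; elim: s i c => [|e s IH] [|i] c h /=; try exact: subgroup0.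
  by case: e h => h; [exact: subgroup0|apply: h].
case: e h => h; [apply: subgroupN => //|]; apply: IH => t st wt; apply: h;
  by rewrite /= ?st ?wt.
Qed.

Lemma contractionB i c b s :
  contraction i (fun t => c t - b t) s = contraction i c s - contraction i b s.
Proof.
elim: s i c b => [|e s IH] [|i] c b; rewrite /= ?subr0 //; case: e; rewrite ?subr0 ?IH //.
by rewrite opprB opprK addrC.
Qed.

Lemma contractionZ i (a : R) c s :
  contraction i (fun t => a *: c t) s = a *: contraction i c s.
Proof.
elim: s i c => [|e s IH] [|i] c; rewrite /= ?scaler0 //; case: e; rewrite ?scaler0 ?IH //.
by rewrite scalerN.
Qed.

Lemma koszul_contraction xs i c s : (i < size xs)%N -> size s = size xs ->
  koszul xs (contraction i c) s + contraction i (koszul xs c) s = xs`_i *: c s.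
Proof.
elim: xs i c s => [|x xs IH] [|i] c [|e s] //= i_xs [ss]; case: e => /=.
- by rewrite koszul0 subr0 addr0.
- by rewrite addrC subrK.
- have -> : koszul xs (fun t => - contraction i (fun t0 => c (true :: t0)) t) s =
      - koszul xs (contraction i (fun t0 => c (true :: t0))) s.
    rewrite -[RHS]sub0r -[in RHS](koszul0 xs s) -koszulB.
    by congr (koszul xs _ s); apply/funext => t; rewrite sub0r.
  rewrite (contractionB i (fun t => x *: c (false :: t))) contractionZ
    -(IH i (fun t => c (true :: t))) //.
  by rewrite opprK opprB (addrC (x *: _)) -addrA; congr (_ + _); rewrite addrC subrK.
- by rewrite -(IH i (fun t => c (false :: t))).
Qed.

End Koszul.

Lemma koszul_linear (R : comNzRingType) (V W : lmodType R) (f : {linear V -> W}) xs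
  (c : seq bool -> V) s : koszul xs (fun t => f (c t)) s = f (koszul xs c s).
Proof.
elim: xs c s => [|x xs IH] c [|[] s] /=; rewrite ?linear0 //.
by rewrite linearB linearZ IH.
Qed.

Section KoszulDegree.
Variables (R : comNzRingType) (V : lmodType R).
Implicit Types (xs : seq R) (c b : seq bool -> V) (s t : seq bool) (P : int -> set V).

(** For entries of degree [d], this shift by the weight makes the differential preserve [n]. The
    family [P] is either the grading or its part that is torsion for some of the entries. *)
Definition cochain (r j : nat) (n d : int) P c :=
  forall s, size s = r -> weight s = j -> P (n + d * (weight s)%:Z) (c s).

(* Cochains of degree j - 1; no condition when j = 0. *)
Definition cochain_pred (r j : nat) (n d : int) P c :=
  forall s, size s = r -> (weight s).+1 = j -> P (n + d * (weight s)%:Z) (c s).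

Lemma koszul_cochain xs P n d j c : (forall m, is_subgroup (P m)) ->
  (forall x m v, x \in xs -> P m v -> P (m + d) (x *: v)) ->
  cochain_pred (size xs) j n d P c -> cochain (size xs) j n d P (koszul xs c).
Proof.
move=> PG PM hc s ss ws; apply: koszul_mem => // x t xx st wt.
rewrite -wt intS mulrDr mulr1 addrCA addrC; apply: PM => //.
by apply: hc; rewrite ?st ?wt.
Qed.

(** The Koszul complex is the cone of its first entry acting on the complex of the others. If that
    entry is [y], which is bijective on [P] modulo [N], the cone is exact; otherwise it is a cone on
    a complex exact by induction. *)
Lemma koszul_contract xs (y : R) P (N : set V) (d : int) :
    (forall m, is_subgroup (P m)) -> is_submodule N -> y \in xs ->
    (forall x m v, x \in xs -> P m v -> P (m + d) (x *: v)) ->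
    (forall m v, P (m + d) v -> exists2 u, P m u & N (v - y *: u)) ->
    (forall m u, P m u -> N (y *: u) -> N u) ->
  forall j n c, cochain (size xs) j n d P c ->
    (forall s, size s = size xs -> weight s = j.+1 -> N (koszul xs c s)) ->
  exists2 b, cochain_pred (size xs) j n d P b &
    forall s, size s = size xs -> weight s = j -> N (c s - koszul xs b s).
Proof.
move=> PG [NG NZ]; elim: xs => [|x xs IH] // yx PM surj inj j n c hc hD.
have PM' z m v : z \in xs -> P m v -> P (m + d) (z *: v).
  by move=> zx; apply: PM; rewrite inE zx orbT.
have NP (a : R) u : N u -> N (a *: u) by exact: NZ.
have [yE|yx'] := eqVneq y x.
  subst x.
  pose b s := if s is false :: t then
    xget 0 [set u | P (n + d * (weight t)%:Z) u /\ N (c (true :: t) - y *: u)] else 0.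
  have bP t : size t = size xs -> (weight t).+1 = j ->
      P (n + d * (weight t)%:Z) (b (false :: t)) /\
      N (c (true :: t) - y *: b (false :: t)).
    move=> st wt; rewrite /b; set Q := [set u | _].
    suff : exists u, Q u by move/(xgetPex 0).
    have [|u Pu Nu] := surj (n + d * (weight t)%:Z) (c (true :: t)).
      rewrite -addrA (_ : _ + d = d * (weight (true :: t))%:Z).
        by apply: hc; rewrite /= ?st ?wt.
      by rewrite /= intS mulrDr mulr1 addrC.
    by exists u.
  exists b; first by move=> [|[] t] //= [st] wt; [exact: subgroup0|by have [] := bP t st wt].
  move=> [|[] t] //= [st] wt.
    have [_ Nb] := bP t st wt.
    by rewrite koszul0 subr0.
  have {}wt : weight t = j := wt.
  apply: (inj (n + d * (weight t)%:Z)).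
    apply: subgroupB => //.
      by have := hc (false :: t); rewrite /= st => /(_ erefl wt).
    have : cochain (size xs) j n d P (koszul xs (fun t => b (false :: t))).
      by apply: koszul_cochain => // t' st' wt'; have [] := bP t' st' wt'.
    by apply.
  rewrite scalerBr -koszulZ.
  rewrite (_ : _ - _ = koszul (y :: xs) c (true :: t) +
    koszul xs (fun t => c (true :: t) - y *: b (false :: t)) t).
    apply: is_subgroupD => //; first by apply: hD; rewrite /= ?st ?wt.
    apply: koszul_mem => // z t' zx st' wt'; apply: NP.
    by have [] := bP t'; rewrite ?st' ?wt' // -wt.
  by rewrite koszulB /= addrA subrK.
have {}yx : y \in xs by move: yx; rewrite inE (negPf yx').
have [|s ss ws|w hw Nw] := IH yx PM' surj inj j n (fun t => c (false :: t)).
- by move=> s ss ws; have := hc (false :: s); rewrite /= ss ws add0n => /(_ erefl erefl).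
- by have := hD (false :: s); rewrite /= ss ws => /(_ erefl erefl).
case: j hc hD hw Nw => [|j] hc hD hw Nw.
  exists (fun s => if s is e :: t then if e then 0 else w t else 0); first by [].
  by move=> [|[] t] //= [st] wt; exact: Nw.
(* After correction by [x *: w], the other half of the cochain is a cocycle modulo [N] of weight one
   less; [n + d] compensates for the lost weight. *)
have [|s ss ws|v hv Nv] := IH yx PM' surj inj j (n + d)
    (fun t => c (true :: t) - x *: w t).
- move=> s ss ws; apply: subgroupB => //.
    have := hc (true :: s); rewrite /= ss ws => /(_ erefl erefl).
    by rewrite intS mulrDr mulr1 addrA.
  by rewrite addrAC; apply: PM; rewrite ?mem_head //; apply: hw => //; rewrite ws.
- have := hD (true :: s); rewrite /= ss ws => /(_ erefl erefl) h.
  rewrite koszulB koszulZ.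
  rewrite (_ : _ - _ = x *: (c (false :: s) - koszul xs w s) -
    (x *: c (false :: s) - koszul xs (fun t => c (true :: t)) s)).
    by apply: subgroupB => //; apply: NP; exact: Nw.
  by rewrite scalerBr opprB [RHS]addrC addrA subrK.
exists (fun s => if s is e :: t then if e then - v t else w t else 0).
  move=> [|[] s] //= [ss] /succn_inj ws; last by apply: hw => //; congr _.+1.
  by rewrite intS mulrDr mulr1 addrA; apply: subgroupN => //; exact: hv.
move=> [|[] s] //= [ss] ws; last exact: Nw.
have -> : koszul xs (fun t => - v t) s = - koszul xs v s.
  rewrite -[RHS]sub0r -[in RHS](koszul0 V xs s) -koszulB.
  by congr (koszul xs _ s); apply/funext => t; rewrite sub0r.
rewrite opprK opprD addrA; by apply: Nv => //; exact: succn_inj ws.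
Qed.

End KoszulDegree.

Lemma ghom_hcomp (R : gradedRing) (M N : gradedModule R) (f : gradedHom M N) n x :
  hcomp (gmod_grading N) n (f x) = f (hcomp (gmod_grading M) n x).
Proof.
elim/(grading_ind (gmod_grading M)): x => [|x y hx hy|m x hx].
- by rewrite linear0 !hcomp0 linear0.
- by rewrite linearD !hcompD hx hy linearD.
- have hfx := ghom_deg f hx.
  have [->|/eqP/nesym mn] := eqVneq n m; first by rewrite !hcomp_id.
  by rewrite (hcomp_neq _ hx mn) (hcomp_neq _ hfx mn) linear0.
Qed.

(** * Torsion and dimension shifting along an injective resolution *)

Section PowerTorsion.
Variables (R : gradedRing) (d : int) (ys : seq R).
Hypothesis ysd : forall y, y \in ys -> gring_deg d y.

Definition ptorsion (V : lmodType R) (zs : seq R) : set V :=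
  [set e | forall z, z \in zs -> exists k, z ^+ k *: e = 0].
Arguments ptorsion {V} zs.

Lemma ptorsion_submodule (V : lmodType R) zs : is_submodule (@ptorsion V zs).
Proof.
split; last first.
  move=> a x hx z /hx[k hk]; exists k.
  by rewrite scalerA mulrC -scalerA hk scaler0.
split=> [z _|x y hx hy z zz]; first by exists 0%N; rewrite scaler0.
have [k hk] := hx z zz; have [l hl] := hy z zz.
exists (k + l)%N; rewrite scalerBr {1}addnC !exprD -!scalerA hk hl.
by rewrite !scaler0 subr0.
Qed.

Let ptorsionG (V : lmodType R) zs := (ptorsion_submodule V zs).1.

Lemma ptorsion_linear (V W : lmodType R) (f : {linear V -> W}) zs x :
  ptorsion zs x -> ptorsion zs (f x).
Proof. by move=> hx z /hx[k hk]; exists k; rewrite -linearZ hk linear0. Qed.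

Lemma ptorsion_hcomp (M : gradedModule R) n (x : M) :
  ptorsion ys x -> ptorsion ys (hcomp (gmod_grading M) n x).
Proof.
move=> hx z zy; have [k hk] := hx z zy; exists k.
by rewrite -(hcompZ _ _ (gring_degX k (ysd zy))) hk hcomp0.
Qed.

Lemma ptorsion_koszul (V : lmodType R) zs (c : seq bool -> V) s :
  (forall t, size t = size s -> (weight t).+1 = weight s -> ptorsion zs (c t)) ->
  ptorsion zs (koszul ys c s).
Proof.
have [G Z] := ptorsion_submodule V zs.
by move=> h; apply: koszul_mem => // x t _ st wt; apply: Z; exact: h.
Qed.

Lemma koszul_degM (M : gradedModule R) x m (v : M) :
  x \in ys -> gmod_deg m v -> gmod_deg (m + d) (x *: v).
Proof. by move=> xy hv; rewrite addrC; apply: gmodZ => //; exact: ysd. Qed.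

Let degG (M : gradedModule R) m : is_subgroup (@gmod_deg R M m).
Proof.
split; first exact: grading0 (gmod_grading M) m.
exact: (gradingB (gmod_grading M)).
Qed.

Notation cochain := (cochain (size ys)).
Notation cochain_pred := (cochain_pred (size ys)).
Notation deg := (@gmod_deg R _).

(* An injective E splits along y-torsion: multiplication by y is bijective on
   the quotients of the filtration of E by the torsion with respect to longer
   and longer initial parts of ys, hence contracts their Koszul complexes. *)
Lemma koszul_exact_mod_torsion (E : gradedModule R) :
  ideal_acc R -> graded_injective E -> forall j n (c : seq bool -> E),
  cochain j n d deg c ->
  (forall s, size s = size ys -> weight s = j.+1 -> ptorsion ys (koszul ys c s)) ->
  exists2 b, cochain_pred j n d deg b &
    forall s, size s = size ys -> weight s = j -> ptorsion ys (c s - koszul ys b s).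
Proof.
move=> accR Einj j n c hc hD.
(* For empty [zs] every element is torsion and 0 will do. Each new entry [z] improves the error
   [c - koszul b], which is already [zs]-torsion, by one more boundary. *)
suff h zs : {subset zs <= ys} -> exists2 b, cochain_pred j n d deg b &
    forall s, size s = size ys -> weight s = j -> ptorsion zs (c s - koszul ys b s).
  exact: h.
elim: zs => [|z zs IH] sub.
  by exists (fun=> 0) => // s _ _; exact: (subgroup0 (degG E _)).
have [x xs|b hb Nb] := IH; first by apply: sub; rewrite inE xs orbT.
have zy : z \in ys by apply: sub; rewrite mem_head.
pose P m : set E := [set v | ptorsion zs v /\ deg m v].
have [|||||||b' hb' Nb'] := @koszul_contract R E ys z P (ptorsion (z :: zs)) d _ _ zy
    _ _ _ j n (fun s => c s - koszul ys b s).
- move=> m; split=> [|u v [? ?] [? ?]].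
    by split; [exact: (subgroup0 (ptorsionG E zs))|exact: (grading0 (gmod_grading E))].
  by split; [exact: (subgroupB (ptorsionG E zs))|exact: (gradingB (gmod_grading E))].
- exact: ptorsion_submodule.
- move=> x m v xy [hv dv]; split; last exact: koszul_degM.
  by have [_] := ptorsion_submodule E zs; apply.
(* The quotient by [z] inherits all annihilators of [v], so it is still [zs]-torsion: [z] is
   surjective on [zs]-torsion modulo torsion for [z :: zs]. *)
- move=> m v [hv dv].
  have [u [k [du uE ann]]] := graded_injective_divide accR Einj (ysd zy) dv.
  have hu : ptorsion zs u by move=> w /hv[l hl]; exists l; exact: ann.
  exists u; first by rewrite addrK in du.
  move=> w; rewrite inE => /predU1P[->|wz].
    by exists k; rewrite scalerBr scalerA -exprSr uE subrr.
  apply: (subgroupB (ptorsionG E zs) hv) wz.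
  by have [_] := ptorsion_submodule E zs; apply.
- move=> m u [hu _] hzu w; rewrite inE => /predU1P[->|]; last exact: hu.
  have [k hk] := hzu z (mem_head _ _).
  by exists k.+1; rewrite exprSr -scalerA.
- move=> s ss ws; split; first exact: Nb.
  apply: (gradingB (gmod_grading E)); first exact: hc.
  by apply: (koszul_cochain (j := j)) => // x m v; exact: koszul_degM.
- move=> s ss ws; rewrite koszulB koszul_koszul subr0 => w wz.
  by apply: hD => //; exact: sub.
exists (fun s => b s + b' s).
  move=> s ss ws; apply: (gradingD (gmod_grading E)); first exact: hb.
  by have [] := hb' s ss ws.
by move=> s ss ws; rewrite koszulD opprD addrA; exact: Nb'.
Qed.

Section Resolution.
Variables (M : gradedModule R) (E : injResolution M).
Hypothesis accR : ideal_acc R.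

Local Notation df := (res_diff E).
Local Notation aug := (res_aug E).

Lemma res_diff_diff q x : df q.+1 (df q x) = 0.
Proof. by apply/res_exactS; exists x. Qed.

Lemma res_diff_aug m : df 0%N (aug m) = 0.
Proof. by apply/res_exact0; exists m. Qed.

(** Exactness of a resolution mentions no degrees, but the degree [n] component of any preimage is
    again a preimage. *)
Lemma res_lift q n (x : E q.+1) : deg n x -> df q.+1 x = 0 ->
  exists y, deg n y /\ x = df q y.
Proof.
move=> dx /res_exactS[y xE]; exists (hcomp (gmod_grading (E q)) n y).
split; first exact: hcomp_deg.
by rewrite -ghom_hcomp -xE hcomp_id.
Qed.

Lemma res_lift0 n (x : E 0%N) : deg n x -> df 0%N x = 0 ->
  exists y, deg n y /\ x = aug y.
Proof.
move=> dx /res_exact0[y xE]; exists (hcomp (gmod_grading M) n y).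
split; first exact: hcomp_deg.
by rewrite -ghom_hcomp -xE hcomp_id.
Qed.

Definition torsion_boundaries (q : nat) : set (E q) :=
  match q return set (E q) with
  | 0%N => [set 0]
  | q'.+1 => [set x | exists2 y, ptorsion ys y & x = df q' y]
  end.

Lemma torsion_boundaries_sub q : @torsion_boundaries q `<=` ptorsion ys.
Proof.
case: q => [|q] x; first by move=> ->; exact: (subgroup0 (ptorsionG _ _)).
by move=> [y hy ->]; exact: ptorsion_linear.
Qed.

(* The degree n part of H^j(K, Z^q), where Z^q is the q-th cocycle module of the
   resolution, comes from the torsion of the preceding term: what remains of the
   vanishing of H^(j+q)(K, M) after q dimension shifts. *)
Definition shifted_vanishing n j q := forall c : seq bool -> E q,
  cochain j n d deg c ->
  (forall s, size s = size ys -> weight s = j -> df q (c s) = 0) ->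
  (forall s, size s = size ys -> weight s = j.+1 -> koszul ys c s = 0) ->
  exists b, [/\ cochain_pred j n d deg b,
    forall s, size s = size ys -> (weight s).+1 = j -> df q (b s) = 0 &
    forall s, size s = size ys -> weight s = j ->
      torsion_boundaries (c s - koszul ys b s)].

(** The connecting map of 0 -> Z^q -> E^q -> Z^(q+1) -> 0. A lift [psi] of [c] has a differential in
    Z^q, equal to that of some [b] up to torsion; then [psi - b] is a boundary of [w] modulo
    torsion, and the torsion remainder is carried by [df] to the torsion boundary sought. *)
Lemma shifted_vanishingS n j q :
  shifted_vanishing n j.+1 q -> shifted_vanishing n j q.+1.
Proof.
move=> IH c hc dc Dc.
pose psi s := xget 0 [set y : E q | deg (n + d * (weight s)%:Z) y /\ c s = df q y].
have psiP s : size s = size ys -> weight s = j ->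
    deg (n + d * (weight s)%:Z) (psi s) /\ c s = df q (psi s).
  move=> ss ws; rewrite /psi; set Q := [set y | _].
  suff : exists y, Q y by move/(xgetPex 0).
  by apply: res_lift; [exact: hc|exact: dc].
have [|s ss ws|s ss ws|b [hb db Nb]] := IH (koszul ys psi).
- apply: koszul_cochain => [m|x m v|s ss [ws]]; [exact: degG|exact: koszul_degM|].
  by have [] := psiP s ss ws.
- rewrite -koszul_linear -(Dc s ss ws); apply: koszul_eq => t; rewrite ss ws => st [wt].
  by have [_ ->] := psiP t st wt.
- by rewrite koszul_koszul.
have [|s ss ws|w hw Nw] := koszul_exact_mod_torsion accR (@res_inj _ _ E q)
    (j := j) (n := n) (c := fun s => psi s - b s).
- move=> s ss ws; apply: (gradingB (gmod_grading (E q))).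
    by have [] := psiP s ss ws.
  by apply: hb => //; rewrite ws.
- by rewrite koszulB; apply/torsion_boundaries_sub/Nb.
exists (fun s => df q (w s)); split.
- by move=> s ss ws; apply: ghom_deg; exact: hw.
- by move=> s ss ws; exact: res_diff_diff.
move=> s ss ws; rewrite koszul_linear; exists (psi s - b s - koszul ys w s); first exact: Nw.
have [_ ->] := psiP s ss ws.
by rewrite !linearB (db s) ?ws // subr0.
Qed.

(** Being killed by [ys], [z] is a Koszul cocycle of degree 0 with values in Z^i, and [i] shifts
    reduce it to Koszul cohomology of [M] in degree [i]. No cochain precedes degree 0, so [z] itself
    must be a torsion boundary. *)
Lemma torsion_exact i n :
    (forall c : seq bool -> M, cochain i n d deg c ->
      (forall s, size s = size ys -> weight s = i.+1 -> koszul ys c s = 0) ->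
      exists2 b, cochain_pred i n d deg b &
        forall s, size s = size ys -> weight s = i -> c s = koszul ys b s) ->
  forall z : E i, deg n z -> (forall y, y \in ys -> y *: z = 0) -> df i z = 0 ->
  torsion_boundaries z.
Proof.
move=> HM z dz yz dfz.
have base : shifted_vanishing n i 0.
  move=> c hc dc Dc.
  pose m s := xget 0 [set y : M | deg (n + d * (weight s)%:Z) y /\ c s = aug y].
  have mP s : size s = size ys -> weight s = i ->
      deg (n + d * (weight s)%:Z) (m s) /\ c s = aug (m s).
    move=> ss ws; rewrite /m; set Q := [set y | _].
    suff : exists y, Q y by move/(xgetPex 0).
    by apply: res_lift0; [exact: hc|exact: dc].
  have [|s ss ws|b hb bE] := HM m; first by move=> s ss ws; have [] := mP s ss ws.
    apply: (@res_aug_inj _ _ E); rewrite linear0 -koszul_linear -(Dc s ss ws).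
    by apply: koszul_eq => t; rewrite ss ws => st [wt]; have [_ ->] := mP t st wt.
  exists (fun s => aug (b s)); split=> s ss ws.
  - by apply: ghom_deg; exact: hb.
  - exact: res_diff_aug.
  - have [_ ->] := mP s ss ws.
    by rewrite koszul_linear -bE // subrr.
have step q : (q <= i)%N -> shifted_vanishing n (i - q) q.
  elim: q => [|q IH] qi; first by rewrite subn0.
  by apply: shifted_vanishingS; rewrite subnSK //; apply: IH; exact: ltnW.
have := step i (leqnn i); rewrite subnn => h.
pose s0 := nseq (size ys) false.
have ss0 : size s0 = size ys by rewrite size_nseq.
have ws0 : weight s0 = 0%N by rewrite count_nseq mul0n.
have [s ss ws|||b [_ _ Nb]] := h (fun=> z).
- by rewrite ws mulr0 addr0.
- by [].
- move=> s ss ws; apply: (@koszul_mem _ _ [set 0]).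
    by split=> // _ _ -> ->; rewrite subr0.
  by move=> x t xy _ _; exact: yz.
have := Nb s0 ss0 ws0.
rewrite (@koszul_eq _ _ _ b (fun=> 0)) ?koszul0 ?subr0 // => t _.
by rewrite ws0.
Qed.

End Resolution.
End PowerTorsion.
Arguments ptorsion {R V} zs _.

(** * Surjectivity of the last Koszul map in high degrees *)

Section TopKoszul.
Variables (R : gradedRing) (d : int) (ys : seq R).
Hypothesis ysd : forall y, y \in ys -> gring_deg d y.
Hypothesis d_ge0 : 0 <= d.
Variables (M : gradedModule R) (E : injResolution M).
Hypothesis accR : ideal_acc R.
Variables (n0 : int) (q0 : nat).

Local Notation df := (res_diff E).
Local Notation aug := (res_aug E).
Local Notation cochain := (cochain (size ys)).
Local Notation cochain_pred := (cochain_pred (size ys)).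
Local Notation deg := (@gmod_deg R _).

Hypothesis torsion_vanishing : forall q n (x : E q), (q <= q0)%N -> n0 <= n -> deg n x ->
  ptorsion ys x -> df q x = 0 -> torsion_boundaries ys x.

Let ptorsionG (V : lmodType R) := (ptorsion_submodule V ys).1.

Let degG (N : gradedModule R) m : is_subgroup (@gmod_deg R N m).
Proof.
split; first exact: grading0 (gmod_grading N) m.
exact: (gradingB (gmod_grading N)).
Qed.

Lemma degree_ge n s : n0 <= n -> n0 <= n + d * (weight s)%:Z.
Proof. by move=> h; rewrite ler_wpDr // mulr_ge0. Qed.

Lemma torsion_lift q n (x : E q.+1) : (q < q0)%N -> n0 <= n -> deg n x ->
  ptorsion ys x -> df q.+1 x = 0 -> exists t, [/\ deg n t, ptorsion ys t & x = df q t].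
Proof.
move=> qq nn dx hx /(torsion_vanishing qq nn dx hx)[y hy xE].
exists (hcomp (gmod_grading (E q)) n y); split; first exact: hcomp_deg.
  exact: (ptorsion_hcomp ysd).
by rewrite -ghom_hcomp -xE hcomp_id.
Qed.

(* Exactness in degree j of the Koszul complex of the q-th cocycle module of the
   complex of the quotients of the E^i by their torsion. *)
Definition exact_mod_torsion j q := forall n (c : seq bool -> E q), n0 <= n ->
  cochain j n d deg c ->
  (forall s, size s = size ys -> weight s = j -> ptorsion ys (df q (c s))) ->
  (forall s, size s = size ys -> weight s = j.+1 -> ptorsion ys (koszul ys c s)) ->
  exists b, [/\ cochain_pred j n d deg b,
    forall s, size s = size ys -> (weight s).+1 = j -> ptorsion ys (df q (b s)) &
    forall s, size s = size ys -> weight s = j -> ptorsion ys (c s - koszul ys b s)].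

(** Exactness for E^q gives some [b], which need not be a cocycle modulo torsion. But [df b] is a
    Koszul cocycle, so modulo torsion it is the boundary of some [e]; once [e] is lifted to E^q, the
    boundary of the lift is subtracted from [b]. *)
Lemma exact_mod_torsionS j q : (q.+1 < q0)%N ->
  exact_mod_torsion j q.+1 -> exact_mod_torsion j.+1 q.
Proof.
move=> qq IH n c nn hc dc Dc.
have [b hb Nb] := koszul_exact_mod_torsion ysd accR (@res_inj _ _ E q) hc Dc.
have hb' : cochain j n d deg b by move=> s ss ws; apply: hb; rewrite ?ws.
have [|s ss ws|s ss ws|e [he de Ne]] := IH n (fun s => df q (b s)) nn.
- by move=> s ss ws; apply: ghom_deg; exact: hb'.
- by rewrite res_diff_diff; exact: (subgroup0 (ptorsionG _)).
- rewrite koszul_linear -[koszul _ _ _](subKr (c s)) linearB.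
  apply: (subgroupB (ptorsionG _)); first exact: dc.
  by apply: ptorsion_linear; exact: Nb.
(* [df (e s)] is a torsion cocycle of E^(q+2), so by vanishing it comes from a torsion [t]; then
   [e s - t] is a true cocycle and lifts to E^q. This is where [q.+1 < q0] is needed. *)
pose Q s (z : E q * E q.+1) := [/\ deg (n + d * (weight s)%:Z) z.1,
  deg (n + d * (weight s)%:Z) z.2, ptorsion ys z.2 & e s = z.2 + df q z.1].
pose w s : E q * E q.+1 := xget (0, 0) (Q s).
have wP s : size s = size ys -> (weight s).+1 = j -> Q s (w s).
  move=> ss ws; suff : exists z, Q s z by move/(xgetPex (0, 0)).
  have les := @degree_ge n s nn.
  have [||| t [dt ht tE]] := @torsion_lift q.+1 _ (df q.+1 (e s)) qq les.
  - by apply: ghom_deg; exact: he.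
  - exact: de.
  - exact: res_diff_diff.
  have [||y [dy yE]] := @res_lift _ _ E q (n + d * (weight s)%:Z) (e s - t).
  - by apply: (gradingB (gmod_grading _)) => //; exact: he.
  - by rewrite linearB tE subrr.
  by exists (y, t); split=> //=; rewrite -yE addrC subrK.
exists (fun s => b s - koszul ys (fun t => (w t).1) s); split.
- move=> s ss [ws]; apply: (gradingB (gmod_grading _)); first exact: hb'.
  apply: (koszul_cochain (j := j)) => // [x m v|t st wt]; first exact: koszul_degM.
  by have [] := wP t st wt.
- move=> s ss [ws]; rewrite linearB -koszul_linear.
  have -> : koszul ys (fun t => df q (w t).1) s =
      koszul ys e s - koszul ys (fun t => (w t).2) s.
    rewrite -koszulB; apply: koszul_eq => t; rewrite ss ws => st wt.
    by have [_ _ _ ->] := wP t st wt; rewrite addrC addKr.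
  rewrite opprB addrCA; apply: (is_subgroupD (ptorsionG _)); last exact: Ne.
  by apply: ptorsion_koszul => t; rewrite ss ws => st wt; have [] := wP t st wt.
- by move=> s ss ws; rewrite koszulB koszul_koszul subr0; exact: Nb.
Qed.

Lemma exact_mod_torsion_le j q : (q + j < q0)%N -> exact_mod_torsion j q.
Proof.
elim: j q => [|j IH] q qj; last first.
  rewrite addnS -addSn in qj; apply: exact_mod_torsionS; last exact: IH.
  exact: leq_ltn_trans (leq_addr _ _) qj.
move=> n c nn hc dc Dc; exists (fun=> 0); split=> // s ss ws.
have [b hb Nb] := koszul_exact_mod_torsion ysd accR (@res_inj _ _ E q) hc Dc.
have := Nb s ss ws; rewrite koszul0.
by rewrite (@koszul_eq _ _ _ b (fun=> 0)) ?koszul0 // => t _; rewrite ws.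
Qed.

(** In top Koszul degree every cochain is a cocycle, so [aug m] is a boundary modulo torsion. Its
    primitive is corrected by torsion to come from [M]; what remains is a torsion cocycle of E^0 in
    the image of [M], which vanishes in these degrees. *)
Lemma top_koszul_surjective n (m : M) : (size ys < q0)%N -> n0 <= n ->
    gmod_deg (n + d * (size ys)%:Z) m ->
  exists2 b, cochain_pred (size ys) n d deg b & m = koszul ys b (nseq (size ys) true).
Proof.
move=> rq nn dm; set s1 := nseq (size ys) true.
have ws1 : weight s1 = size ys by rewrite count_nseq mul1n.
have ss1 : size s1 = size ys by rewrite size_nseq.
have [|s ss ws|s ss ws|s ss ws|b [hb db Nb]] :=
    @exact_mod_torsion_le (size ys) 0 _ n (fun=> aug m) nn.
- by [].
- by rewrite ws; exact: ghom_deg.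
- by rewrite res_diff_aug; exact: (subgroup0 (ptorsionG _)).
- by have := count_size id s; rewrite ss ws ltnn.
pose Q s (z : M * E 0%N) := [/\ deg (n + d * (weight s)%:Z) z.1,
  ptorsion ys z.2 & b s = z.2 + aug z.1].
pose w s : M * E 0%N := xget (0, 0) (Q s).
have wP s : size s = size ys -> (weight s).+1 = size ys -> Q s (w s).
  move=> ss ws; suff : exists z, Q s z by move/(xgetPex (0, 0)).
  have les := @degree_ge n s nn.
  have [||||t [dt ht tE]] := @torsion_lift 0 _ (df 0%N (b s)) _ les.
  - exact: leq_ltn_trans rq.
  - by apply: ghom_deg; exact: hb.
  - exact: db.
  - exact: res_diff_diff.
  have [||y [dy yE]] := @res_lift0 _ _ E (n + d * (weight s)%:Z) (b s - t).
  - by apply: (gradingB (gmod_grading _)) => //; exact: hb.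
  - by rewrite linearB tE subrr.
  by exists (y, t); split=> //=; rewrite -yE addrC subrK.
exists (fun s => (w s).1).
  by move=> s ss ws; have [] := wP s ss ws.
apply/eqP; rewrite -subr_eq0; apply/eqP/(@res_aug_inj _ _ E); rewrite linear0.
have dK : deg (n + d * (size ys)%:Z) (m - koszul ys (fun s => (w s).1) s1).
  apply: (gradingB (gmod_grading _)) => //; rewrite -ws1.
  apply: (koszul_cochain (j := size ys)) => // [x k v|t st wt]; first exact: koszul_degM.
  by have [] := wP t st wt.
apply: (@torsion_vanishing 0 _ _ _ _ (ghom_deg _ dK)) => //.
- by rewrite -ws1; exact: degree_ge.
- rewrite linearB -koszul_linear.
  have -> : koszul ys (fun t => aug (w t).1) s1 =
      koszul ys b s1 - koszul ys (fun t => (w t).2) s1.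
    rewrite -koszulB; apply: koszul_eq => t; rewrite ss1 ws1 => st wt.
    by have [_ _ ->] := wP t st wt; rewrite addrC addKr.
  rewrite opprB addrCA; apply: (is_subgroupD (ptorsionG _)); last exact: Nb.
  by apply: ptorsion_koszul => t; rewrite ss1 ws1 => st wt; have [] := wP t st wt.
- exact: res_diff_aug.
Qed.

End TopKoszul.

(** * Koszul cohomology of graded noetherian modules *)

Section Devissage.
Variables (R : gradedRing) (M : gradedModule R) (xs : seq R).
Hypothesis xs1 : forall x, x \in xs -> gring_deg 1 x.
Hypothesis graded_acc : forall N : nat -> set M, (forall i, graded_submodule (N i)) ->
  (forall i, N i `<=` N i.+1) -> exists i0, forall i, (i0 <= i)%N -> N i `<=` N i0.

(** Otherwise each counterexample has a strictly larger one, and iterating the choice contradicts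
    [graded_acc]. *)
Lemma graded_noetherian_ind (P : set M -> Prop) :
  (forall N, graded_submodule N ->
    (forall N', graded_submodule N' -> N `<=` N' -> ~ (N' `<=` N) -> P N') -> P N) ->
  forall N, graded_submodule N -> P N.
Proof.
move=> step N0 gN0; apply: contrapT => nP0.
pose bad := {N : set M | graded_submodule N /\ ~ P N}.
have next (N : bad) : exists N' : bad, sval N `<=` sval N' /\ ~ (sval N' `<=` sval N).
  case: N => N [gN nP] /=; apply: contrapT => h; apply: nP; apply: step => // N' gN' NN' nN.
  by apply: contrapT => nP'; apply: h; exists (exist _ N' (conj gN' nP')).
pose f N := projT1 (cid (next N)).
have fP N : sval N `<=` sval (f N) /\ ~ (sval (f N) `<=` sval N).
  by rewrite /f; case: cid.
pose ch i := iter i f (exist _ N0 (conj gN0 nP0)).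
have [i|i|i0 h] := graded_acc (N := fun i => sval (ch i)).
- by case: (ch i) => N [].
- by have [] := fP (ch i).
- by have [_] := fP (ch i0); apply; exact: h i0.+1 (leqnSn _).
Qed.

Variable bound : int.
(** The starting point of the devissage: M/N is zero from degree [bound] on if all of [xs] kill
    it. *)
Hypothesis generated_below : forall N : set M, graded_submodule N ->
  (forall x v, x \in xs -> N (x *: v)) -> forall n v, bound <= n -> gmod_deg n v -> N v.

Local Notation pows k := [seq x ^+ k | x <- xs].
Local Notation deg := (@gmod_deg R M).

(* The Koszul cohomology of M/N vanishes in high degrees, uniformly in k. *)
Definition koszul_vanishing (N : set M) := forall j, exists n0 : int, forall (k : nat) n
    (c : seq bool -> M), n0 <= n -> cochain (size xs) j n k%:Z deg c ->
    (forall s, size s = size xs -> weight s = j.+1 -> N (koszul (pows k) c s)) ->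
  exists2 b, cochain_pred (size xs) j n k%:Z deg b &
    forall s, size s = size xs -> weight s = j -> N (c s - koszul (pows k) b s).

Let degG m : is_subgroup (deg m).
Proof.
split; first exact: grading0 (gmod_grading M) m.
exact: (gradingB (gmod_grading M)).
Qed.

Lemma pows_degM k x m v : x \in pows k -> deg m v -> deg (m + k%:Z) (x *: v).
Proof.
move=> /mapP[y yx ->] hv; rewrite addrC; apply: gmodZ => //.
by rewrite -[k%:Z]mul1r; apply: gring_degX; exact: xs1.
Qed.

Lemma koszul_pows_cochain k j n b : cochain_pred (size xs) j n k%:Z deg b ->
  cochain (size xs) j n k%:Z deg (koszul (pows k) b).
Proof.
by rewrite -(size_map (fun x => x ^+ k)); apply: koszul_cochain => //; exact: pows_degM.
Qed.

Section Step.
Variables (N : set M) (y : R).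
Hypotheses (Ng : graded_submodule N) (yx : y \in xs).

Let N1 : set M := [set v | N (y *: v)].
Let N2 : set M := [set v | exists u, N (v - y *: u)].

Let NG : is_subgroup N. Proof. by case: Ng => [[]]. Qed.
Let NZ a v : N v -> N (a *: v). Proof. by case: Ng => [[_ h] _]; exact: h. Qed.

Lemma colon_graded : graded_submodule N1.
Proof.
have [_ NC] := Ng; split; last first.
  move=> n v /(NC (1 + n)); rewrite (hcompZ _ _ (xs1 yx)); exact.
split; last by move=> a v h; rewrite /N1 /= scalerA mulrC -scalerA; exact: NZ.
by split=> [|u v hu hv]; rewrite /N1 /= ?scaler0 ?scalerBr; [exact: subgroup0|exact: subgroupB].
Qed.

Lemma sum_graded : graded_submodule N2.
Proof.
have [_ NC] := Ng; split; last first.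
  move=> n v [u /(NC n)]; rewrite hcompB -[n in hcomp _ n (y *: u)](subrKC 1).
  by rewrite (hcompZ _ _ (xs1 yx)) => h; eexists; exact: h.
split; last first.
  move=> a v [u h]; exists (a *: u).
  by rewrite scalerA mulrC -scalerA -scalerBr; exact: NZ.
split=> [|v v' [u h] [u' h']]; first by exists 0; rewrite scaler0 subr0; exact: subgroup0.
by exists (u - u'); rewrite scalerBr opprD addrACA -opprD; exact: subgroupB.
Qed.

Lemma sum_homogeneous m v : deg (m + 1) v -> N2 v -> exists u, deg m u /\ N (v - y *: u).
Proof.
have [_ NC] := Ng; move=> dv [u /(NC (1 + m))]; rewrite hcompB (hcompZ _ _ (xs1 yx)).
rewrite hcomp_id; last by rewrite addrC.
by move=> h; exists (hcomp (gmod_grading M) m u); split=> //; exact: hcomp_deg.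
Qed.

Lemma colon_sub : N `<=` N1. Proof. by move=> v; exact: NZ. Qed.
Lemma sum_sub : N `<=` N2.
Proof. by move=> v Nv; exists 0; rewrite scaler0 subr0. Qed.

Lemma koszul_mem_sub k (c : seq bool -> M) s :
  (forall t, size t = size s -> (weight t).+1 = weight s -> N (c t)) ->
  N (koszul (pows k) c s).
Proof. by move=> h; apply: koszul_mem => // x t _ st wt; apply: NZ; exact: h. Qed.

(* When y is regular on M/N, the vanishing for M/(N + yM) makes y injective on the
   Koszul cohomology of M/N in high degrees, whereas y^k annihilates it. *)
Lemma koszul_vanishing_regular :
  N1 `<=` N -> koszul_vanishing N2 -> koszul_vanishing N.
Proof.
(* The kernel of [y] on the j-th cohomology of M/N comes from the cohomology of M/(N + yM) in degree
   j - 1. For j = 0 there is nothing before, and [y] is injective on M/N itself. *)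
move=> N1N U2 j; have [n0 U] := U2 j.-1; exists n0 => k n c nn hc Dc.
have claim n' (c' : seq bool -> M) b : n0 <= n' -> cochain (size xs) j n' k%:Z deg c' ->
    cochain_pred (size xs) j (n' + 1) k%:Z deg b ->
    (forall s, size s = size xs -> weight s = j -> N (y *: c' s - koszul (pows k) b s)) ->
    exists2 b, cochain_pred (size xs) j n' k%:Z deg b &
      forall s, size s = size xs -> weight s = j -> N (c' s - koszul (pows k) b s).
  move=> nn' hc' hb Nb; case: j U hc hc' Dc hb Nb => [|j] U hc hc' Dc hb Nb.
    exists (fun=> 0) => // s ss ws; rewrite koszul0 subr0; apply: N1N; rewrite /N1 /=.
    have := Nb s ss ws.
    by rewrite (@koszul_eq _ _ _ b (fun=> 0)) ?koszul0 ?subr0 // => t _; rewrite ws.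
  have hb' : cochain (size xs) j (n' + 1) k%:Z deg b.
    by move=> s ss ws; apply: hb; rewrite ?ws.
  have [|s ss ws|e he Ne] := U k (n' + 1) b _ hb'; first by rewrite ler_wpDr.
    exists (c' s); rewrite -opprB; apply: subgroupN => //; exact: Nb.
  pose beta s := xget 0 [set u : M | deg (n' + k%:Z * (weight s)%:Z) u /\
    N (b s - koszul (pows k) e s - y *: u)].
  have betaP s : size s = size xs -> weight s = j ->
      deg (n' + k%:Z * (weight s)%:Z) (beta s) /\
      N (b s - koszul (pows k) e s - y *: beta s).
    move=> ss ws; rewrite /beta; set Q := [set u | _].
    suff : exists u, Q u by move/(xgetPex 0).
    apply: sum_homogeneous; last exact: Ne.
    rewrite addrAC; apply: subgroupB => //; first exact: hb'.
    exact: koszul_pows_cochain he s ss ws.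
  exists beta; first by move=> s ss [ws]; have [] := betaP s ss ws.
  move=> s ss ws; apply: N1N; rewrite /N1 /= scalerBr -koszulZ.
  rewrite (_ : _ - _ = (y *: c' s - koszul (pows k) b s) +
      koszul (pows k) (fun t => b t - koszul (pows k) e t - y *: beta t) s).
    apply: is_subgroupD => //; first exact: Nb.
    apply: koszul_mem_sub => t; rewrite ss ws => st [wt].
    by have [] := betaP t st wt.
  by rewrite !koszulB koszul_koszul subr0 addrA subrK.
(* The factors [y] are stripped one at a time; multiplying by [y] only raises the internal degree,
   so the bound [n0] is kept whatever [l] is. *)
have claims l : forall n' (c' : seq bool -> M) b, n0 <= n' ->
    cochain (size xs) j n' k%:Z deg c' ->
    cochain_pred (size xs) j (n' + l%:Z) k%:Z deg b ->
    (forall s, size s = size xs -> weight s = j ->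
      N (y ^+ l *: c' s - koszul (pows k) b s)) ->
    exists2 b, cochain_pred (size xs) j n' k%:Z deg b &
      forall s, size s = size xs -> weight s = j -> N (c' s - koszul (pows k) b s).
  elim: l => [|l IH] n' c' b nn' hc' hb Nb.
    exists b; first by rewrite addr0 in hb.
    by move=> s ss ws; have := Nb s ss ws; rewrite expr0 scale1r.
  have [||||b' hb' Nb'] := IH (n' + 1) (fun s => y *: c' s) b.
  - by rewrite ler_wpDr.
  - move=> s ss ws; rewrite addrAC addrC; apply: gmodZ; [exact: xs1|exact: hc'].
  - by rewrite -addrA -intS.
  - by move=> s ss ws; rewrite scalerA -exprSr; exact: Nb.
  exact: claim hb' Nb'.
(* The contraction along [y ^+ k] exhibits [y ^+ k *: c] as a boundary modulo [N]; only the number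
   of steps depends on [k], not [n0]. *)
apply: (claims k n c (contraction (index y xs) c)) => //.
  move=> s ss ws; apply: contraction_mem => // t st wt.
  have := hc t; rewrite st wt ss => /(_ erefl ws).
  by rewrite intS mulrDr mulr1 addrA.
move=> s ss ws.
have := @koszul_contraction _ _ (pows k) (index y xs) c s.
rewrite size_map index_mem yx ss (nth_map 0) ?index_mem // nth_index // => <- //.
rewrite addrAC subrr add0r; apply: contraction_mem => // t st wt.
by apply: Dc; rewrite ?st ?wt ?ws.
Qed.

(** The middle of the long exact sequence of 0 -> M/(N : y) -> M/N -> M/(N + yM) -> 0, whose first
    map is multiplication by [y]. Since [y] has degree 1, the bound for M/(N : y) moves by 1. *)
Lemma koszul_vanishing_ext :
  koszul_vanishing N1 -> koszul_vanishing N2 -> koszul_vanishing N.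
Proof.
move=> U1 U2 j; have [n1 V1] := U1 j; have [n2 V2] := U2 j.
exists (Num.max (n1 + 1) n2) => k n c; rewrite ge_max => /andP[nn1 nn2] hc Dc.
have [|e he Ne] := V2 k n c nn2 hc; first by move=> s ss ws; apply: sum_sub; exact: Dc.
pose c' s := xget 0 [set u : M | deg (n - 1 + k%:Z * (weight s)%:Z) u /\
    N (c s - koszul (pows k) e s - y *: u)].
have cP s : size s = size xs -> weight s = j ->
    deg (n - 1 + k%:Z * (weight s)%:Z) (c' s) /\
    N (c s - koszul (pows k) e s - y *: c' s).
  move=> ss ws; rewrite /c'; set Q := [set u | _].
  suff : exists u, Q u by move/(xgetPex 0).
  apply: sum_homogeneous; last exact: Ne.
  rewrite addrAC subrK; apply: subgroupB => //; first exact: hc.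
  exact: koszul_pows_cochain he s ss ws.
have [|||b hb Nb] := V1 k (n - 1) c'.
- by rewrite lerBrDr.
- by move=> s ss ws; have [] := cP s ss ws.
- move=> s ss ws; rewrite /N1 /= -koszulZ.
  rewrite (_ : koszul _ _ _ = koszul (pows k) c s -
      koszul (pows k) (fun t => c t - koszul (pows k) e t - y *: c' t) s).
    apply: subgroupB => //; first exact: Dc.
    apply: koszul_mem_sub => t; rewrite ss ws => st [wt].
    by have [] := cP t st wt.
  by rewrite !koszulB koszul_koszul subr0 opprB addrC subrK.
exists (fun s => e s + y *: b s).
  move=> s ss ws; apply: (is_subgroupD (degG _)); first exact: he.
  rewrite (_ : n + _ = 1 + (n - 1 + k%:Z * (weight s)%:Z)); last by ring.
  by apply: gmodZ; [exact: xs1|exact: hb].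
move=> s ss ws; rewrite koszulD koszulZ opprD addrA.
rewrite (_ : _ - _ = (c s - koszul (pows k) e s - y *: c' s) +
  y *: (c' s - koszul (pows k) b s)); last by rewrite scalerBr addrA subrK.
apply: is_subgroupD => //; last exact: Nb.
by have [] := cP s ss ws.
Qed.

End Step.

(** Unless R_+ kills M/N, some [x] makes N + xM strictly larger than [N]; then N : x is either [N],
    the regular case, or strictly larger too. *)
Lemma koszul_vanishing_all N : graded_submodule N -> koszul_vanishing N.
Proof.
move: N; apply: graded_noetherian_ind => N Ng IH.
have [h|h] := pselect (forall x v, x \in xs -> N (x *: v)).
  move=> j; exists bound => k n c nn hc _; have NG := Ng.1.1.
  exists (fun=> 0) => [s _ _|s ss ws]; first exact: subgroup0.
  rewrite koszul0 subr0; apply: (generated_below Ng h _ (hc s ss ws)).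
  by rewrite ler_wpDr // mulr_ge0.
have [x [v [xx nN]]] : exists x v, x \in xs /\ ~ N (x *: v).
  apply: contrapT => h'; apply: h => x v xx; apply: contrapT => nN.
  by apply: h'; exists x, v.
have U2 : koszul_vanishing [set v | exists u, N (v - x *: u)].
  apply: IH; [exact: sum_graded|exact: sum_sub|].
  move=> sub; apply: nN; apply: sub; exists v; rewrite subrr.
  by have NG := Ng.1.1; exact: subgroup0.
have [sub|nsub] := pselect ([set v | N (x *: v)] `<=` N).
  exact: koszul_vanishing_regular Ng xx sub U2.
apply: (koszul_vanishing_ext Ng xx) => //.
by apply: IH => //; [exact: colon_graded|exact: colon_sub].
Qed.

End Devissage.

(** * Existence of graded injective resolutions *)

Section Divisible.
Variables (G D : zmodType).
Hypothesis divD : forall (n : nat) (x : D), (0 < n)%N -> exists y, y *+ n = x.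

Definition functional (Ga : set (G * D)) := forall d, Ga (0, d) -> d = 0.

Lemma subgroupMz (V : zmodType) (A : set V) x (m : int) :
  is_subgroup A -> A x -> A (x *~ m).
Proof.
move=> AG Ax; have An n : A (x *+ n).
  elim: n => [|n IH]; first by rewrite mulr0n; exact: subgroup0.
  by rewrite mulrS; exact: is_subgroupD.
by case: m => n; rewrite ?NegzE ?mulrNz; [exact: An|apply: subgroupN => //; exact: An].
Qed.

(* The multiples of x on which a homomorphism with graph A is defined prescribe
   the value at x: it is a division by the smallest of them. *)
Lemma extend_one (A : set (G * D)) (x : G) : is_subgroup A -> functional A ->
  exists d : D, forall (m : int) e, A (x *~ m, e) -> e = d *~ m.
Proof.
move=> AG Af.
have [[n hn]|none] := pselect (exists n, `[< (0 < n)%N /\ exists e, A (x *+ n, e) >]).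
  have ex : exists n, `[< (0 < n)%N /\ exists e, A (x *+ n, e) >] by exists n.
  case: (ex_minnP ex) => n0 /asboolP[n0_gt0 [e0 Ae0]] min_n0.
  have [d dE] := divD e0 n0_gt0; exists d => m e Ae.
  have n0z : n0%:Z != 0 by rewrite eqz_nat -lt0n.
  pose q := (m %/ n0%:Z)%Z; pose r := `|(m %% n0%:Z)%Z|%N.
  have rE : r%:Z = (m %% n0%:Z)%Z by rewrite /r gez0_abs // modz_ge0.
  have mE : m = n0%:Z * q + r%:Z by rewrite rE mulrC -divz_eq.
  have Ar : A (x *+ r, e - e0 *~ q).
    have -> : (x *+ r, e - e0 *~ q) = (x *~ m, e) - ((x *+ n0, e0) : G * D) *~ q.
      have -> : ((x *+ n0, e0) : G * D) *~ q = (x *+ n0 *~ q, e0 *~ q).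
        have hMn k : ((x *+ n0, e0) : G * D) *+ k = (x *+ n0 *+ k, e0 *+ k).
          by elim: k => [|k IH] //; rewrite !mulrS IH.
        by case: (q) => k; rewrite ?NegzE ?mulrNz -!pmulrn hMn.
      congr (_, _); rewrite mE mulrzDr mulrzA -!pmulrn addrC addKr.
      by [].
    by apply: subgroupB => //; exact: subgroupMz.
  have r0 : r = 0%N.
    apply/eqP; rewrite -leqn0 leqNgt; apply/negP => r_gt0.
    have /min_n0 : `[< (0 < r)%N /\ exists e, A (x *+ r, e) >].
      by apply/asboolP; split=> //; eexists; exact: Ar.
    by rewrite leqNgt -ltz_nat rE ltz_pmod // ltz_nat.
  rewrite r0 mulr0n in Ar; have /eqP := Af _ Ar; rewrite subr_eq0 => /eqP ->.
  by rewrite mE r0 addr0 mulrzA -pmulrn dE.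
exists 0 => m e Ae; rewrite mul0rz.
have [m0|m0] := eqVneq m 0; first by move: Ae; rewrite m0 mulr0z; exact: Af.
exfalso; apply: none; exists `|m|%N; apply/asboolP; split; first by rewrite absz_gt0.
case: m Ae m0 => k Ae _; first by exists e.
exists (- e); have -> : (x *+ `|Negz k|, - e) = - ((x *~ Negz k, e) : G * D).
  by congr (_, _); rewrite NegzE mulrNz opprK.
exact: subgroupN.
Qed.

(** Divisible groups are injective: Zorn's lemma on graphs of partial homomorphisms, where
    [extend_one] shows that a maximal graph is total. *)
Lemma divisible_extension (Ga : set (G * D)) : is_subgroup Ga -> functional Ga ->
  exists f : G -> D, (forall x y, f (x - y) = f x - f y) /\
    forall x d, Ga (x, d) -> f x = d.
Proof.
move=> GaG Gaf.
pose P (X : set (G * D)) := X = set0 \/ [/\ Ga `<=` X, is_subgroup X & functional X].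
have [F FP tot|A [PA Amax]] := @Zorn_bigcup _ P.
  have [all0|] := pselect (forall X, F X -> X = set0).
    left; apply/seteqP; split=> // z [X FX Xz].
    by rewrite (all0 X FX) in Xz.
  move=> /existsNP[X0 /not_implyP[FX0 X0n]].
  have good X z : F X -> X z -> [/\ Ga `<=` X, is_subgroup X & functional X].
    by move=> FX; have [->|h] := FP X FX.
  have [GaX0 _ _] : [/\ Ga `<=` X0, is_subgroup X0 & functional X0].
    by have [] := FP X0 FX0.
  right; split.
  - by move=> z /GaX0 hz; exists X0.
  - split; first by exists X0 => //; apply: GaX0; exact: subgroup0.
    move=> u v [X FX Xu] [Y FY Yv].
    have [XY|YX] := tot X Y FX FY.
      have [_ YG _] := good Y v FY Yv; exists Y => //; apply: subgroupB => //; exact: XY.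
    have [_ XG _] := good X u FX Xu; exists X => //; apply: subgroupB => //; exact: YX.
  - by move=> d [X FX Xd]; have [_ _ h] := good X _ FX Xd; exact: (h d Xd).
case: PA => [A0|[GaA AG Af]].
  exfalso; apply: (Amax Ga); last by right; split.
  rewrite A0; split=> [z []|sub]; exact: (sub _ (subgroup0 GaG)).
have total x : exists d, A (x, d).
  have [d hd] := extend_one x AG Af.
  pose B : set (G * D) := [set z | exists (m : int), A (z - (x *~ m, d *~ m))].
  have AB : A `<=` B.
    move=> z Az; exists 0; rewrite !mulr0z.
    by have -> : z - (0, 0) = z by exact: subr0.
  have BG : is_subgroup B.
    split; first by apply: AB; exact: subgroup0.
    move=> u v [m hm] [k hk]; exists (m - k).
    have -> : u - v - (x *~ (m - k), d *~ (m - k)) =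
        (u - (x *~ m, d *~ m)) - (v - (x *~ k, d *~ k)).
      have -> : (x *~ (m - k), d *~ (m - k)) = (x *~ m, d *~ m) - (x *~ k, d *~ k).
        by congr (_, _); exact: mulrzBr.
      by rewrite !opprB addrACA [RHS]addrACA; congr (_ + _); rewrite addrC.
    exact: subgroupB.
  have Bf : functional B.
    move=> w [m hm]; have := hd (- m) (w - d *~ m).
    have -> : (x *~ - m, w - d *~ m) = (0, w) - (x *~ m, d *~ m) :> G * D.
      by congr (_, _); rewrite sub0r mulrNz.
    move=> /(_ hm) /eqP; rewrite mulrNz subr_eq addNr.
    by move/eqP.
  have BA : B `<=` A.
    apply: contrapT => nBA; apply: (Amax B); first by split.
    by right; split=> // z /GaA /AB.
  exists d; apply: BA; exists 1; rewrite !mulr1z subrr; exact: subgroup0.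
pose f x := projT1 (cid (total x)).
have fA x : A (x, f x) by rewrite /f; case: cid.
have uniqA x d e : A (x, d) -> A (x, e) -> d = e.
  move=> hd he; apply/eqP; rewrite -subr_eq0; apply/eqP/Af.
  have -> : (0, d - e) = (x, d) - (x, e) :> G * D by congr (_, _); rewrite subrr.
  exact: subgroupB.
exists f; split=> [x y|x d /GaA hx]; last exact: uniqA (fA x) hx.
apply: uniqA (fA _) _; exact: (subgroupB AG (fA x) (fA y)).
Qed.

End Divisible.

Definition int_rat : {pred rat} := fun q => q \is a Num.int.

Lemma int_rat_closed : zmod_closed int_rat.
Proof. by split=> [|x y hx hy]; rewrite unfold_in ?rpred0 ?rpredB. Qed.

HB.instance Definition _ := GRing.isZmodClosed.Build rat int_rat int_rat_closed.

Definition QmodZ : zmodType := Quotient.quot int_rat.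

Definition toQmodZ (q : rat) : QmodZ := (\pi q)%qT.

Lemma toQmodZ_eq0 q : toQmodZ q = 0 <-> q \is a Num.int.
Proof.
have h : (q - 0 \in int_rat) = (toQmodZ q == toQmodZ 0).
  exact: Quotient.idealrBE.
rewrite subr0 in h; have -> : 0 = toQmodZ 0 by exact/esym/pi_zeror.
by rewrite -[q \is a _]/(q \in int_rat) h; split=> /eqP.
Qed.

Lemma toQmodZMn q n : toQmodZ (q *+ n) = toQmodZ q *+ n.
Proof.
elim: n => [|n IH]; first by rewrite !mulr0n; exact/pi_zeror.
by rewrite !mulrS -IH; exact: raddfD.
Qed.

Lemma QmodZ_divisible (n : nat) (x : QmodZ) : (0 < n)%N -> exists y : QmodZ, y *+ n = x.
Proof.
move=> n0; exists (toQmodZ (repr x / n%:R)); rewrite -toQmodZMn.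
by rewrite -(mulr_natr (repr x / _)) divfK ?pnatr_eq0 -?lt0n // /toQmodZ reprK.
Qed.

(** Q/Z is an injective cogenerator: a nonzero character on the subgroup generated by [x] in G/N
    extends to [G]. *)
Lemma character_separation (G : zmodType) (N : set G) (x : G) :
  is_subgroup N -> ~ N x -> exists f : G -> QmodZ,
    [/\ forall x y, f (x - y) = f x - f y, forall g, N g -> f g = 0 & f x <> 0].
Proof.
move=> NG nx.
(* The value at [x]: the class of 1/n0 if [x] has finite order [n0] modulo [N]; for infinite order
   any nonzero class will do, here that of 1/2. *)
have [u [u0 hu]] : exists u : QmodZ, u <> 0 /\ forall m : int, N (x *~ m) -> u *~ m = 0.
  have [[n hn]|none] := pselect (exists n, `[< (0 < n)%N /\ N (x *+ n) >]); last first.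
    exists (toQmodZ 2^-1); split; first by move=> /toQmodZ_eq0.
    move=> m Nm; have [->//|m0] := eqVneq m 0.
    exfalso; apply: none; exists `|m|%N; apply/asboolP; split; first by rewrite absz_gt0.
    case: m Nm {m0} => k // Nk; rewrite NegzE mulrNz in Nk.
    by rewrite -[_ *+ _]opprK; exact: subgroupN.
  have ex : exists n, `[< (0 < n)%N /\ N (x *+ n) >] by exists n.
  case: (ex_minnP ex) => n0 /asboolP[n0_gt0 Nn0] min_n0.
  have n1 : (1 < n0)%N.
    rewrite ltn_neqAle n0_gt0 andbT eq_sym; apply/eqP => n01.
    by apply: nx; rewrite n01 in Nn0.
  have n0z : n0%:Z != 0 by rewrite eqz_nat -lt0n.
  exists (toQmodZ n0%:R^-1); split.
    move=> /toQmodZ_eq0 /norm_intr_ge1; rewrite invr_eq0 pnatr_eq0 -lt0n => /(_ n0_gt0).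
    by rewrite ger0_norm ?invr_ge0 ?ler0n // invf_ge1 ?ltr0n // lern1 leqNgt n1.
  move=> m Nm; pose r := `|(m %% n0%:Z)%Z|%N.
  have rE : r%:Z = (m %% n0%:Z)%Z by rewrite /r gez0_abs // modz_ge0.
  have mE : m = n0%:Z * (m %/ n0%:Z)%Z + r%:Z by rewrite rE mulrC -divz_eq.
  have Nr : N (x *+ r).
    have -> : x *+ r = x *~ m - x *+ n0 *~ (m %/ n0%:Z)%Z.
      by rewrite [in x *~ m]mE mulrzDr mulrzA -!pmulrn addrC addKr.
    by apply: subgroupB => //; exact: subgroupMz.
  have r0 : r = 0%N.
    apply/eqP; rewrite -leqn0 leqNgt; apply/negP => r_gt0.
    have /min_n0 : `[< (0 < r)%N /\ N (x *+ r) >] by apply/asboolP.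
    by rewrite leqNgt -ltz_nat rE ltz_pmod // ltz_nat.
  rewrite mE r0 addr0 mulrzA -pmulrn -toQmodZMn.
  rewrite -(mulr_natr _^-1) mulVf ?pnatr_eq0 -?lt0n //.
  have -> : toQmodZ 1 = 0 by apply/toQmodZ_eq0.
  by rewrite mul0rz.
pose Ga : set (G * QmodZ) := [set z | exists m : int, N (z.1 - x *~ m) /\ z.2 = u *~ m].
have [||f [fB fE]] := @divisible_extension G QmodZ QmodZ_divisible Ga.
- split; first by exists 0; rewrite !mulr0z subrr; split=> //; exact: subgroup0.
  move=> [g e] [h e'] [m [/= hm ->]] [k [/= hk ->]]; exists (m - k) => /=.
  split; last by rewrite mulrzBr.
  have -> : g - h - x *~ (m - k) = (g - x *~ m) - (h - x *~ k).
    by rewrite mulrzBr !opprB addrACA [RHS]addrACA; congr (_ + _); rewrite addrC.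
  exact: subgroupB.
- move=> e [m [/= hm ->]]; rewrite sub0r in hm.
  by apply: hu; rewrite -[_ *~ _]opprK; exact: subgroupN.
exists f; split=> //.
  by move=> g Ng; apply: fE; exists 0; rewrite !mulr0z subr0.
by rewrite (fE x u) //; exists 1; rewrite !mulr1z subrr; split=> //; exact: subgroup0.
Qed.

Section Coinduced.
Variables (R : gradedRing) (D : zmodType).

(* Additive maps R -> D^Z, an R-module by (a f)(r) = f (r a). *)
Definition additive_pred : {pred R -> int -> D} :=
  fun f => `[< forall x y, f (x - y) = f x - f y >].

Lemma additive_pred_closed : zmod_closed additive_pred.
Proof.
split=> [|f g /asboolP hf /asboolP hg]; apply/asboolP => x y.
  by apply/funext => l /=; exact/esym/subr0.
change (f (x - y) - g (x - y) = (f x - g x) - (f y - g y)).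
by rewrite hf hg !opprB addrACA [RHS]addrACA; congr (_ + _); exact: addrC.
Qed.

HB.instance Definition _ :=
  GRing.isZmodClosed.Build (R -> int -> D) additive_pred additive_pred_closed.

Record coind := Coind { coind_fun : R -> int -> D; _ : coind_fun \in additive_pred }.

HB.instance Definition _ := [isSub for coind_fun].
HB.instance Definition _ := [Choice of coind by <:].
HB.instance Definition _ := [SubChoice_isSubZmodule of coind by <:].

Lemma coindB (f : coind) x y l :
  coind_fun f (x - y) l = coind_fun f x l - coind_fun f y l.
Proof. by case: f => f /= /asboolP ->. Qed.

Lemma coind0 (f : coind) l : coind_fun f 0 l = 0.
Proof. by rewrite -[X in coind_fun f X](subrr 0) coindB subrr. Qed.

Lemma coindD (f : coind) x y l :
  coind_fun f (x + y) l = coind_fun f x l + coind_fun f y l.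
Proof.
have N z : coind_fun f (- z) l = - coind_fun f z l.
  by rewrite -[- z]sub0r coindB coind0 sub0r.
by rewrite -{1}(opprK y) coindB N opprK.
Qed.

Lemma coind_ext (f g : coind) : (forall r l, coind_fun f r l = coind_fun g r l) -> f = g.
Proof. by move=> h; apply: val_inj; apply/funext => r; apply/funext => l; exact: h. Qed.

Lemma coind_scale_in (a : R) (f : coind) :
  (fun r => coind_fun f (r * a)) \in additive_pred.
Proof.
apply/asboolP => x y; apply/funext => l; rewrite mulrBl coindB; by [].
Qed.

Definition coind_scale a f : coind := Coind (coind_scale_in a f).

Lemma coind_scaleA a b f : coind_scale a (coind_scale b f) = coind_scale (a * b) f.
Proof. by apply: coind_ext => r l /=; rewrite mulrA. Qed.
Lemma coind_scale1 : left_id 1 coind_scale.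
Proof. by move=> f; apply: coind_ext => r l /=; rewrite mulr1. Qed.
Lemma coind_scaleDr : right_distributive coind_scale +%R.
Proof. by move=> a f g; apply: coind_ext. Qed.
Lemma coind_scaleDl f : {morph coind_scale^~ f : a b / a + b}.
Proof. by move=> a b; apply: coind_ext => r l /=; rewrite mulrDr coindD. Qed.

HB.instance Definition _ := GRing.Zmodule_isLmodule.Build R coind
  coind_scaleA coind_scale1 coind_scaleDr coind_scaleDl.

(** D^Z is graded by its coordinates, the l-th one in degree [l]; these are the additive maps
    homogeneous of degree [n]. *)
Definition coind_deg (n : int) : set coind := [set f | forall m r, gring_deg m r ->
  forall l, l <> m + n -> coind_fun f r l = 0].

Lemma coind_degB n : coind_deg n 0 /\
  (forall f g, coind_deg n f -> coind_deg n g -> coind_deg n (f - g)).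
Proof.
split=> [m r _ l _ //|f g hf hg m r hr l hl].
change (coind_fun f r l - coind_fun g r l = 0).
by rewrite (hf m) // (hg m) // subrr.
Qed.

Lemma coind_degZ m n (a : R) (f : coind) :
  gring_deg m a -> coind_deg n f -> coind_deg (m + n) (a *: f).
Proof.
move=> ha hf k r hr l hl; apply: (hf (k + m)); first exact: gringM.
by rewrite -addrA.
Qed.

Local Notation rcomp := (hcomp (gring_grading R)).

Lemma coind_proj_in n (f : coind) :
  (fun r l => coind_fun f (rcomp (l - n) r) l) \in additive_pred.
Proof. by apply/asboolP => x y; apply/funext => l; rewrite hcompB coindB. Qed.

Definition coind_proj n f : coind := Coind (coind_proj_in n f).

Lemma coind_projB n f g : coind_proj n (f - g) = coind_proj n f - coind_proj n g.
Proof. by apply: coind_ext. Qed.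

Lemma coind_proj_id n f : coind_deg n f -> coind_proj n f = f.
Proof.
move=> hf; apply: coind_ext => r l /=.
elim/(grading_ind (gring_grading R)): r => [|x y hx hy|m x hx].
- by rewrite hcomp0.
- by rewrite hcompD !coindD hx hy.
have [lE|/eqP ln] := eqVneq (l - n) m; first by rewrite lE hcomp_id.
rewrite (hcomp_neq _ hx) ?coind0; last exact/nesym.
by rewrite (hf m) // => lE; apply: ln; rewrite lE addrK.
Qed.

Lemma coind_proj_neq m n f : coind_deg n f -> n <> m -> coind_proj m f = 0.
Proof.
move=> hf nm; apply: coind_ext => r l; rewrite [RHS]/=.
apply: (hf (l - m)); first exact: hcomp_deg.
by move=> e; apply: nm; apply: (addrI (l - m)); rewrite -e subrK.
Qed.

Definition coind_preGraded : preGraded R :=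
  PreGraded coind_degB coind_degZ coind_projB coind_proj_id coind_proj_neq.

(** Graded homomorphisms from [N] to it correspond to families of additive maps from the components
    N_l to [D]; [cofree_hom] is the direction that builds a homomorphism. *)
Definition cofree : gradedModule R := gspan_module coind_preGraded.

Section Hom.
Variables (N : gradedModule R) (z : int -> N -> D).
Hypothesis zB : forall l x y, z l (x - y) = z l x - z l y.

Local Notation ncomp := (hcomp (gmod_grading N)).

Lemma coind_of_in (b : N) : (fun r l => z l (ncomp l (r *: b))) \in additive_pred.
Proof. by apply/asboolP => x y; apply/funext => l; rewrite scalerBl hcompB zB. Qed.

Definition coind_of (b : N) : coind := Coind (coind_of_in b).

Lemma coind_of_linear : linear coind_of.
Proof.
move=> a x y; apply: coind_ext => r l /=.
change (z l (ncomp l (r *: (a *: x + y))) =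
  z l (ncomp l ((r * a) *: x)) + z l (ncomp l (r *: y))).
have zD u v : z l (u + v) = z l u + z l v.
  have z0 : z l 0 = 0 by rewrite -[X in z l X](subrr 0) zB subrr.
  by rewrite -{1}(opprK v) zB -{1}(sub0r v) zB z0 sub0r opprK.
by rewrite scalerDr scalerA hcompD zD.
Qed.

Lemma coind_of_deg n b : gmod_deg n b -> coind_deg n (coind_of b).
Proof.
move=> hb m r hr l hl /=; rewrite (hcomp_neq _ (gmodZ hr hb)); last exact/nesym.
by rewrite -[X in z l X](subrr 0) zB subrr.
Qed.

Lemma coind_of_gspan b : coind_of b \in @gspan_pred R coind_preGraded.
Proof.
apply/asboolP; elim/(grading_ind (gmod_grading N)): b => [|x y hx hy|n x hx].
- have -> : coind_of 0 = 0.
    apply: coind_ext => r l /=.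
    by rewrite scaler0 hcomp0 -[X in z l X](subrr 0) zB subrr.
  by have [] := gspan_subgroup coind_preGraded.
- have -> : coind_of (x + y) = coind_of x + coind_of y.
    by rewrite -[X in coind_of (X + _)]scale1r coind_of_linear scale1r.
  exact: (is_subgroupD (gspan_subgroup _)).
- exact: (@gspan_deg R coind_preGraded n _ (coind_of_deg hx)).
Qed.

Definition cofree_of (b : N) : cofree := GSpan (coind_of_gspan b).

Lemma cofree_hom : exists f : gradedHom N cofree, forall b r l,
  coind_fun (gspan_val (f b)) r l = z l (ncomp l (r *: b)).
Proof.
have lin : linear cofree_of by move=> a x y; apply: val_inj; exact: coind_of_linear.
pose L := GRing.isLinear.Build R N cofree *:%R cofree_of lin.
pose f : {linear N -> cofree} := HB.pack cofree_of L.
have fd n (x : N) : gmod_deg n x -> gmod_deg n (f x) by exact: coind_of_deg.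
by exists (GradedHom fd).
Qed.

End Hom.

(** Evaluation at 1 turns [f] into additive maps [xi l]. Divisibility of [D] extends each of them,
    and [cofree_hom] reassembles the extensions. *)
Lemma cofree_injective :
  (forall (n : nat) (x : D), (0 < n)%N -> exists y, y *+ n = x) ->
  graded_injective cofree.
Proof.
move=> divD M N i f inj_i.
pose xi l (a : M) : D := coind_fun (gspan_val (f a)) 1 l.
have xiB l a b : xi l (a - b) = xi l a - xi l b.
  by rewrite /xi linearB.
have xi0 l : xi l 0 = 0 by rewrite -[X in xi l X](subrr 0) xiB subrr.
have iB x y : i (x - y) = i x - i y by exact: linearB.
have ext l : exists g : N -> D, (forall x y, g (x - y) = g x - g y) /\
    forall a, g (i a) = xi l a.
  pose Ga : set (N * D) := [set p | exists a, p = (i a, xi l a)].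
  have [||g [gB gE]] := @divisible_extension N D divD Ga.
  - split; first by exists 0; rewrite linear0 xi0.
    by move=> _ _ [a ->] [b ->]; exists (a - b); rewrite xiB iB.
  - by move=> e [a [/esym ia0 ->]]; rewrite -(linear0 i) in ia0; rewrite (inj_i _ _ ia0) xi0.
  by exists g; split=> // a; apply: gE; exists a.
pose z l := projT1 (cid (ext l)).
have zB l x y : z l (x - y) = z l x - z l y by rewrite /z; case: cid => g [].
have zE l a : z l (i a) = xi l a by rewrite /z; case: cid => g [].
have [g gE] := cofree_hom zB.
exists g => a; apply: val_inj; apply: coind_ext => r l.
rewrite [LHS]gE -linearZ /= ghom_hcomp zE.
(* As [f] preserves degrees, the coordinate [l] at 1 sees only the component of degree [l]. *)
have xic (b : M) : xi l (hcomp (gmod_grading M) l b) = xi l b.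
  elim/(grading_ind (gmod_grading M)): b => [|x y hx hy|m x hx].
  - by rewrite hcomp0.
  - have xiD u v : xi l (u + v) = xi l u + xi l v.
      by rewrite -{1}(opprK v) xiB -{1}(sub0r v) xiB xi0 sub0r opprK.
    by rewrite hcompD !xiD hx hy.
  have [->|/eqP lm] := eqVneq l m; first by rewrite hcomp_id.
  rewrite (hcomp_neq _ hx) ?xi0; last exact/nesym.
  apply/esym; rewrite /xi; have := ghom_deg f hx.
  by move=> /(_ 0 1 (gring1 R)); apply; rewrite add0r.
rewrite xic /xi linearZ.
change (coind_fun (gspan_val (f a)) (1 * r) l = coind_fun (gspan_val (f a)) r l).
by rewrite mul1r.
Qed.

End Coinduced.

Section Resolutions.
Variable R : gradedRing.

Lemma fct_divisible (S : Type) (n : nat) (x : S -> QmodZ) : (0 < n)%N ->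
  exists y : S -> QmodZ, y *+ n = x.
Proof.
move=> n0; have h s : exists y : QmodZ, y *+ n = x s by exact: QmodZ_divisible.
have [y hy] := boolp.choice h.
have e s k : (y *+ k) s = y s *+ k by elim: k => [|k IH] //; rewrite !mulrS -IH.
by exists y; apply/funext => s; rewrite e hy.
Qed.

(** One copy of Q/Z for each element of [E], to receive the character that separates this element
    from a given submodule. *)
Definition cofree_hull (E : gradedModule R) : gradedModule R := cofree R (E -> QmodZ).

Lemma cofree_hull_injective E : graded_injective (cofree_hull E).
Proof. by apply: cofree_injective => n x; exact: fct_divisible. Qed.

(** An embedding of E/K into an injective module, without forming the quotient. *)
Lemma cofree_hull_hom (E : gradedModule R) (K : set E) : graded_submodule K ->
  exists f : gradedHom E (cofree_hull E), forall x, f x = 0 <-> K x.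
Proof.
move=> [[KG KZ] KC].
have sep x : exists f : E -> QmodZ, [/\ forall u v, f (u - v) = f u - f v,
    forall g, K g -> f g = 0 & ~ K x -> f x <> 0].
  have [Kx|nKx] := pselect (K x).
    by exists (fun=> 0); split=> // u v; rewrite subrr.
  by have [f [? ? ?]] := character_separation KG nKx; exists f.
have [chi hchi] := boolp.choice sep.
pose z (l : int) (v : E) : E -> QmodZ := fun x => chi x v.
have zB l u v : z l (u - v) = z l u - z l v.
  by apply/funext => x; have [h _ _] := hchi x; exact: h.
have [f fE] := cofree_hom zB.
exists f => v; split.
  move=> fv0; have [s _ [-> _]] := hcomp_seq (gmod_grading E) v.
  apply: subgroup_sum => // l _; apply: contrapT => nK.
  have := fE v 1 l; rewrite fv0 scale1r => /(congr1 (fun g => g (hcomp (gmod_grading E) l v))).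
  by have [_ _ h] := hchi (hcomp (gmod_grading E) l v) => /esym; exact: h nK.
move=> Kv; apply: val_inj; apply: coind_ext => r l; rewrite [LHS]fE.
by apply/funext => x; have [_ h _] := hchi x; apply/h/KC/KZ.
Qed.

Lemma image_graded (M N : gradedModule R) (f : gradedHom M N) :
  graded_submodule [set y | exists x, y = f x].
Proof.
split; first split.
- split; first by exists 0; rewrite linear0.
  by move=> _ _ [x ->] [y ->]; exists (x - y); rewrite linearB.
- by move=> a _ [x ->]; exists (a *: x); rewrite linearZ.
- by move=> n _ [x ->]; exists (hcomp (gmod_grading M) n x); rewrite ghom_hcomp.
Qed.

Lemma injResolution_exists (M : gradedModule R) : inhabited (injResolution M).
Proof.
(* A state is a module with the kernel prescribed for the next map: 0 at first, for an injective
   augmentation, then the image of the previous map, for exactness. *)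
pose St := {E : gradedModule R & {K : set E | graded_submodule K}}.
pose hm (s : St) := projT1 (cid (cofree_hull_hom (svalP (projT2 s)))).
have hmP (s : St) x : hm s x = 0 <-> sval (projT2 s) x by rewrite /hm; case: cid.
pose nxt (s : St) : St := existT _ (cofree_hull (projT1 s))
  (exist _ _ (image_graded (hm s))).
have zero_graded : graded_submodule [set 0 : M].
  split; first split.
  - by split=> // _ _ -> ->; rewrite subrr.
  - by move=> a _ ->; rewrite scaler0.
  - by move=> n _ ->; rewrite hcomp0.
pose s0 : St := existT _ M (exist _ _ zero_graded).
pose st i := iter i nxt s0.
constructor; apply: (@InjResolution R M (fun i => projT1 (st i.+1))
  (fun i => hm (st i.+1)) (hm s0)).
- by move=> i; exact: cofree_hull_injective.
- move=> x y xy; apply/eqP; rewrite -subr_eq0; apply/eqP.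
  by apply/(hmP s0); rewrite linearB xy subrr.
- by move=> x; exact: (hmP (st 1%N)).
- by move=> i x; exact: (hmP (st i.+2)).
Qed.

End Resolutions.

(** * Reductions and integral closures *)

Section Reduction.
Variable A : comNzRingType.
Implicit Types (I J K : set A).

Lemma ideal_genP (g : seq A) z : ideal_gen [set` g] z ->
  exists b : nat -> A, z = \sum_(j < size g) b j * g`_j.
Proof.
apply: (_ : ideal_gen [set` g] `<=`
  [set z | exists b : nat -> A, z = \sum_(j < size g) b j * g`_j]) => {z}.
apply: smallest_sub.
  split=> [|x y [b ->] [c ->]|a x [b ->]].
  - by exists (fun=> 0); rewrite big1 // => j _; rewrite mul0r.
  - exists (fun j => b j + c j); rewrite -big_split.
    by apply: eq_bigr => j _; rewrite mulrDl.
  - exists (fun j => a * b j); rewrite mulr_sumr.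
    by apply: eq_bigr => j _; rewrite mulrA.
move=> x /= xg; exists (fun j => (j == index x g)%:R).
have ix : (index x g < size g)%N by rewrite index_mem.
rewrite (bigD1 (Ordinal ix)) //= eqxx mul1r nth_index // big1 ?addr0 // => j ji.
by rewrite (_ : (j == index x g :> nat) = false) ?mul0r //; exact: negbTE ji.
Qed.

Lemma ideal_mul_genP K (g : seq A) z : is_ideal K ->
  ideal_mul K (ideal_gen [set` g]) z ->
  exists b : nat -> A, (forall j, K (b j)) /\ z = \sum_(j < size g) b j * g`_j.
Proof.
move=> [K0 KD KM].
apply: (_ : ideal_mul K (ideal_gen [set` g]) `<=` [set z | exists b : nat -> A,
  (forall j, K (b j)) /\ z = \sum_(j < size g) b j * g`_j]) => {z}.
apply: smallest_sub.
  split=> [|x y [b [hb ->]] [c [hc ->]]|a x [b [hb ->]]].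
  - by exists (fun=> 0); split=> //; rewrite big1 // => j _; rewrite mul0r.
  - exists (fun j => b j + c j); split; first by move=> j; exact: KD.
    by rewrite -big_split; apply: eq_bigr => j _; rewrite mulrDl.
  - exists (fun j => a * b j); split; first by move=> j; exact: KM.
    by rewrite mulr_sumr; apply: eq_bigr => j _; rewrite mulrA.
move=> _ [x [y [Kx /ideal_genP[b ->] ->]]]; exists (fun j => x * b j); split.
  by move=> j; rewrite mulrC; exact: KM.
by rewrite mulr_sumr; apply: eq_bigr => j _; rewrite mulrA.
Qed.

Lemma ideal_mul_ideal I J : is_ideal (ideal_mul I J).
Proof. exact: ideal_gen_ideal. Qed.

(* [sum_k p_k X^k] with [p_k] in [K^(e-k)]: in an equation of degree e, this is
   the condition imposed by integral dependence on K. *)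
Definition weighted K (e : nat) : set {poly A} :=
  [set p | forall k, ideal_exp K (e - k) p`_k].

Lemma weighted_subgroup K e : is_subgroup (weighted K e).
Proof.
split=> [k|p q hp hq k]; have G := ideal_subgroup (ideal_exp_ideal K (e - k)).
  by rewrite coef0; exact: subgroup0.
by rewrite coefB; exact: subgroupB.
Qed.

Lemma ideal_expM K m n x y : ideal_exp K m x -> ideal_exp K n y ->
  ideal_exp K (m + n) (x * y).
Proof. by move=> hx hy; apply: ideal_exp_mul; apply: sub_gen_smallest; exists x, y. Qed.

Lemma weightedM K e f p q : weighted K e p -> weighted K f q -> weighted K (e + f) (p * q).
Proof.
move=> hp hq k; rewrite coefM; apply: subgroup_sum.
  exact: ideal_subgroup (ideal_exp_ideal _ _).
move=> i _; have ik : (i <= k)%N by rewrite -ltnS ltn_ord.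
apply: (@ideal_exp_sub _ K ((e - i) + (f - (k - i)))); last exact: ideal_expM.
by lia.
Qed.

Lemma weighted_prod K (I : Type) (r : seq I) (f : I -> {poly A}) :
  (forall i, weighted K 1 (f i)) -> weighted K (size r) (\prod_(i <- r) f i).
Proof.
move=> h; elim: r => [|i r IH]; first by rewrite big_nil => k.
by rewrite big_cons /= -add1n; exact: weightedM.
Qed.

Lemma weighted_char_poly K n (M : 'M[A]_n) : is_ideal K ->
  (forall i j, K (M i j)) -> weighted K n (char_poly M).
Proof.
move=> Ki hM; have WG := weighted_subgroup K n.
have K1 x : K x -> ideal_exp K 1 x.
  by move=> Kx; rewrite -[x]mulr1; apply: sub_gen_smallest; exists x, 1.
rewrite /char_poly /determinant; apply: subgroup_sum => // s _.
have : weighted K n (\prod_i char_poly_mx M i (s i)).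
  have sn : size (index_enum 'I_n) = n by rewrite -[RHS]card_ord cardT enumT.
  rewrite -[X in weighted K X]sn.
  apply: weighted_prod => i k; rewrite !mxE coefB coefMn coefX coefC.
  have G := ideal_subgroup (ideal_exp_ideal K (1 - k)).
  case: k G => [|k] G //=; rewrite mul0rn sub0r.
  exact: subgroupN (K1 _ (hM _ _)).
by case: odd_perm; rewrite ?expr1 ?expr0 ?mulN1r ?mul1r //; exact: subgroupN.
Qed.

Lemma integral_of_weighted K n (p : {poly A}) x : (0 < n)%N -> p \is monic ->
  size p = n.+1 -> weighted K n p -> p.[x] = 0 -> integral_closure K x.
Proof.
move=> n0 pm sp hp px0; exists n, (fun i => p`_(n - i)); split=> //.
  by move=> i /andP[_ i_n]; have := hp (n - i)%N; rewrite subKn.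
rewrite -[RHS]px0 horner_coef sp big_ord_recr /= [RHS]addrC.
have -> : p`_n = 1 by move/monicP: pm; rewrite lead_coefE sp.
rewrite mul1r; congr (_ + _).
rewrite big_add1 /= big_mkord (reindex_inj rev_ord_inj) /=; apply: eq_bigr => i _.
by rewrite subnSK // subKn // ltnW.
Qed.

(* Determinant trick: x maps J_n into I^m J_n, so that the characteristic
   polynomial of this multiplication, evaluated at x, kills J_n, which contains
   a power of x. *)
Lemma reduction_integral (noethA : noetherian A) I (F : multFiltration A) (c : nat) :
    (forall n, (c <= n)%N -> F n.+1 `<=` ideal_mul I (F n)) ->
  forall m : nat, (1 <= m)%N -> F m `<=` integral_closure (ideal_exp I m).
Proof.
(* At least 1, so that the equation found has positive degree even when the list of generators of
   [F n] is empty. *)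
move=> red m m1 x Fx; pose n := maxn c 1.
have Fmn k : F (k + n)%N `<=` ideal_mul (ideal_exp I k) (F n).
  elim: k => [|k IH].
    by move=> y Fy; apply: sub_gen_smallest; exists 1, y; rewrite mul1r.
  have cn : (c <= k + n)%N by rewrite (leq_trans (leq_maxl c 1)) // leq_addl.
  move=> y /(red _ cn); apply: smallest_sub; first exact: ideal_gen_ideal.
  move=> _ [a [z [Ia /IH Fz ->]]].
  apply: (_ : ideal_mul (ideal_exp I k) (F n) `<=`
    [set z | ideal_mul (ideal_exp I k.+1) (F n) (a * z)]) Fz.
  have [h0 hD hM] := ideal_mul_ideal (ideal_exp I k.+1) (F n).
  apply: smallest_sub.
    split=> [|u v hu hv|b u hu] /=; rewrite ?mulr0 ?mulrDr //; first exact: hD.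
    by rewrite mulrCA; exact: hM.
  move=> _ [u [v [hu hv ->]]] /=; rewrite mulrA; apply: sub_gen_smallest.
  exists (a * u), v; split=> //; apply: sub_gen_smallest; by exists a, u.
have [g gE] := noethA _ (filt_ideal F n).
pose r := size g.
have rowP (i : 'I_r) : exists b : nat -> A, (forall j, ideal_exp I m (b j)) /\
    x * g`_i = \sum_(j < r) b j * g`_j.
  apply: ideal_mul_genP; first exact: ideal_exp_ideal.
  rewrite -gE; apply: Fmn; apply: filtM => //; rewrite gE.
  by apply: sub_gen_smallest; exact: mem_nth.
have [b hb] := boolp.choice rowP.
pose M : 'M[A]_r := \matrix_(i, j) b i j.
pose G : 'cV[A]_r := \col_j g`_j.
have MG : (x%:M - M) *m G = 0.
  apply/matrixP => i j; rewrite mulmxBl mul_scalar_mx !mxE (hb i).2.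
  by rewrite -sumrB big1 // => k _; rewrite !mxE subrr.
have detE : \det (x%:M - M) = (char_poly M).[x].
  rewrite /char_poly -/(horner_eval x _) -det_map_mx; congr (\det _).
  apply/matrixP => i j; rewrite !mxE.
  by rewrite -[RHS]/(('X *+ (i == j) - (b i j)%:P).[x]) !(hornerE, hornerMn).
have kill j : (j < r)%N -> (char_poly M).[x] * g`_j = 0.
  move=> jr; have := congr1 (mulmx (\adj (x%:M - M))) MG.
  rewrite mulmx0 mulmxA mul_adj_mx mul_scalar_mx detE => /matrixP /(_ (Ordinal jr) 0).
  by rewrite !mxE.
have n1 : (1 <= n)%N by exact: leq_maxr.
have Fxn : F n (x ^+ n).
  have Fp k : F (k * m)%N (x ^+ k).
    elim: k => [|k IH]; first by rewrite expr0 filt0.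
    by rewrite exprS mulSn; exact: filtM.
  have Fle j : F (j + n)%N `<=` F n.
    by elim: j => [|j IH] // y /filt_dec /IH.
  by apply: (Fle (n * m - n)%N); rewrite subnK ?leq_pmulr.
have px0 : (char_poly M * 'X^n).[x] = 0.
  rewrite hornerM hornerXn; rewrite gE in Fxn; have [e ->] := ideal_genP Fxn.
  by rewrite mulr_sumr big1 // => j _; rewrite mulrCA kill ?mulr0.
apply: (@integral_of_weighted _ (r + n) (char_poly M * 'X^n)) => //.
- by rewrite addn_gt0 n1 orbT.
- by rewrite rpredM ?char_poly_monic ?monicXn.
- by rewrite size_monicM ?char_poly_monic ?monic_neq0 ?monicXn //
    size_char_poly size_polyXn addnS.
apply: weightedM.
  apply: weighted_char_poly; first exact: ideal_exp_ideal.
  by move=> i j; rewrite mxE; have [] := hb i.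
move=> k; rewrite coefXn; case: eqP => [->|_]; first by rewrite subnn.
by have [] := ideal_exp_ideal (ideal_exp I m) (n - k).
Qed.

End Reduction.

(** * Rees modules *)

Section ReesModules.
Variables (A : comNzRingType) (I : set A) (s : seq A).
Hypothesis IE : I = ideal_gen [set` s].

Lemma rees_polyP (F : multFiltration A) (p : rees F) : rees_set F (rees_poly p).
Proof. by case: p => p /= /asboolP. Qed.

Definition mk_rees (F : multFiltration A) (p : {poly A}) (hp : rees_set F p) : rees F :=
  Rees (introT (asboolP (rees_set F p)) hp).

Lemma rees_poly_inj (F : multFiltration A) : injective (@rees_poly A F).
Proof. exact: val_inj. Qed.

Lemma gen_in a : a \in s -> rees_set (adic I) (a *: 'X).
Proof. by move=> sa; apply: (rees_ops_sub IE); right; apply/mapP; exists a. Qed.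

Definition rees_gen (a : A) : rees_ring I :=
  if pselect (rees_set (adic I) (a *: 'X)) is left h then mk_rees h else 0.

Lemma rees_genE a : a \in s -> rees_poly (rees_gen a : rees (adic I)) = a *: 'X.
Proof. by move=> /gen_in h; rewrite /rees_gen; case: pselect. Qed.

Definition rees_gens : seq (rees_ring I) := map rees_gen s.

Lemma rees_gens_deg1 x : x \in rees_gens -> gring_deg 1 x.
Proof.
move=> /mapP[a sa ->] k k1; rewrite rees_genE // coefZ coefX.
have [kE|_] := eqVneq k 1%N; first by rewrite kE in k1.
by rewrite mulr0.
Qed.

(* The closure properties of N are spelled out on the underlying polynomials so
   as to apply both to submodules of R(F) and to ideals of A[It]. *)
Lemma rees_span (F : multFiltration A) (N : set (rees F)) :
    I `<=` F 1%N -> N 0 -> (forall u v, N u -> N v -> N (u + v)) ->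
    (forall a u w, N u -> rees_poly w = a *: rees_poly u -> N w) ->
    (forall a (u w : rees F), a \in s -> rees_poly w = a *: (rees_poly u * 'X) -> N w) ->
  forall m b w, ideal_mul I (F m) b -> rees_poly w = b *: 'X^(m.+1) -> N w.
Proof.
move=> IF1 N0 ND NZ Ns m b w hb wE.
(* The parameter [y] separates two inductions: [T 1] handles sums of products [x * y], and [T y],
   with [y] fixed, handles [x] as a combination of generators of [I]. *)
pose T y := [set b | exists v : rees F, rees_poly v = (b * y) *: 'X^(m.+1) /\ N v].
have Ti y : is_ideal (T y).
  split=> [|u v [p [pE Np]] [q [qE Nq]]|a u [p [pE Np]]].
  - by exists 0; rewrite rees0 mul0r scale0r.
  - by exists (p + q); split; [rewrite reesD pE qE mulrDl scalerDl|exact: ND].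
  - have h : rees_set F (a *: rees_poly p).
      move=> n; rewrite coefZ; have [_ _ hM] := filt_ideal F n; apply: hM.
      exact: rees_polyP.
    exists (mk_rees h); split; last exact: NZ Np _.
    by rewrite /= pE scalerA mulrA.
have [v [vE Nv]] : T 1 b.
  apply: (_ : ideal_mul I (F m) `<=` T 1) hb; apply: smallest_sub => //.
  move=> _ [x [y [Ix Fy ->]]].
  suff [v [vE Nv]] : T y x by exists v; rewrite mulr1.
  apply: (_ : I `<=` T y) Ix; rewrite [X in X `<=` _]IE; apply: smallest_sub => // a sa.
  have hy : rees_set F (y *: 'X^m).
    move=> n; rewrite coefZ coefXn; case: eqP => [->|_]; rewrite ?mulr1 // mulr0.
    by have [] := filt_ideal F n.
  have haF : rees_set F ((a * y) *: 'X^(m.+1)).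
    have Fa : F m.+1 (a * y).
      by apply: (@filtM _ F 1); [apply: IF1; rewrite IE; exact: sub_gen_smallest|].
    move=> n; rewrite coefZ coefXn; case: eqP => [->|_]; rewrite ?mulr1 // mulr0.
    by have [] := filt_ideal F n.
  exists (mk_rees haF); split=> //; apply: (Ns a (mk_rees hy)) => //=.
  by rewrite -scalerAl -exprSr scalerA.
have -> // : w = v by apply: rees_poly_inj; rewrite wE vE mulr1.
Qed.

Lemma ideal_exp1 : ideal_exp I 1 = I.
Proof.
have [_ _ IM] := ideal_gen_ideal [set` s]; rewrite -IE in IM.
apply/seteqP; split=> [|x Ix].
  apply: smallest_sub; first by rewrite [X in is_ideal X]IE; exact: ideal_gen_ideal.
  by move=> _ [x [y [Ix _ ->]]]; rewrite mulrC; exact: IM.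
by apply: sub_gen_smallest; exists x, 1; rewrite mulr1.
Qed.

Lemma rees_plus_gen : rees_plus I `<=` ideal_gen [set` rees_gens].
Proof.
move=> p p0; pose T := ideal_gen [set` rees_gens].
have [T0 TD TM] : is_ideal T := ideal_gen_ideal _.
pose q : rees (adic I) := p; have hq := rees_polyP q.
suff [v [vE Tv]] : exists v : rees_ring I,
    rees_poly (v : rees (adic I)) = \sum_(i < size (rees_poly q)) (rees_poly q)`_i *: 'X^i /\ T v.
  suff -> : p = v by [].
  by apply: rees_poly_inj; rewrite vE -poly_def coefK.
elim: (size _) => [|k [v [vE Tv]]].
  by exists 0; rewrite big_ord0; split=> //; exact: rees0.
have hk : rees_set (adic I) ((rees_poly q)`_k *: 'X^k).
  move=> n; rewrite coefZ coefXn; case: eqP => [->|_]; rewrite ?mulr1 // mulr0.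
  by have [] := filt_ideal (adic I) n.
exists (v + mk_rees hk); split; first by rewrite big_ord_recr /= -vE.
apply: (TD v (mk_rees hk : rees_ring I)) => //; case: k hk {vE} => [|k] hk.
  suff -> : mk_rees hk = 0 by [].
  by apply: rees_poly_inj; rewrite [LHS]/= p0 scale0r; exact/esym/rees0.
apply: (@rees_span (adic I) T) (hq k.+1) _ => //.
- by rewrite -[X in X `<=` _]ideal_exp1.
- move=> a u w Tu wE.
  have ha : rees_set (adic I) a%:P.
    by apply: (rees_ops_sub IE); left; exists a.
  suff -> : w = mk_rees ha * u by exact: TM.
  by apply: rees_poly_inj; rewrite reesM wE mul_polyC.
- move=> a u w sa wE; suff -> : w = u * rees_gen a.
    by apply: TM; apply: sub_gen_smallest; exact: map_f.
  by apply: rees_poly_inj; rewrite reesM rees_genE // wE scalerAr.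
Qed.

Section Torsion.
Variable M : gradedModule (rees_ring I).

(** A pigeonhole on exponents: replacing [v] by [x *: v] lowers the exponent of [x] by one, and an
    exponent 0 means that [v] is zero. *)
Lemma torsion_kill (K : nat) (e : rees_ring I -> nat) (v : M) :
  (forall x, x \in rees_gens -> x ^+ e x *: v = 0) ->
  (\sum_(x <- rees_gens) e x <= K)%N ->
  forall r, ideal_exp (rees_plus I) K.+1 r -> r *: v = 0.
Proof.
elim: K e v => [|K IH] e v ev eK r;
  apply: (_ : ideal_exp (rees_plus I) _ `<=` [set r | r *: v = 0]) => {r}.
all: apply: smallest_sub; first by split=> /= [|a b ha hb|a b hb];
  rewrite ?scale0r ?scalerDl ?ha ?hb ?addr0 // -scalerA hb scaler0.
all: move=> _ [p [q [/rees_plus_gen hp hq ->]]] /=.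
all: apply: (_ : ideal_gen [set` rees_gens] `<=` [set p | (p * q) *: v = 0]) hp.
all: apply: smallest_sub; first by split=> /= [|a b ha hb|a b hb];
  rewrite ?mul0r ?scale0r ?mulrDl ?scalerDl ?ha ?hb ?addr0 // -mulrA -scalerA hb scaler0.
all: move=> x xg /=; have [ex0|ex0] := posnP (e x);
  first by have := ev x xg; rewrite ex0 expr0 scale1r => ->; rewrite scaler0.
  move: eK; rewrite leqn0 sum_nat_seq_eq0 => /allP /(_ x xg) /=.
  by rewrite -leqn0 leqNgt ex0.
rewrite mulrC -scalerA; apply: (IH (fun y => if y == x then (e x).-1 else e y)) => //.
  move=> y yg; case: eqP => [->|_].
    by rewrite scalerA -exprSr prednK // ev.
  by rewrite scalerA mulrC -scalerA ev // scaler0.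
rewrite -ltnS; apply: leq_trans eK.
rewrite !(big_rem x xg) /= eqxx -addSn prednK // leq_add2l.
by apply: leq_sum => y _; case: eqP => [->|//]; exact: leq_pred.
Qed.

Lemma torsionP (v : M) : torsion (rees_plus I) v <-> ptorsion rees_gens v.
Proof.
split=> [[k hk] x xg|hv].
  exists k; apply: hk; elim: k => [|k IH]; first by rewrite expr0.
  rewrite exprS; apply: sub_gen_smallest; exists x, (x ^+ k); split=> //.
  have := rees_gens_deg1 xg; rewrite /rees_plus /=; exact.
have ex x : exists k, x \in rees_gens -> x ^+ k *: v = 0.
  have [xg|xg] := boolP (x \in rees_gens); last by exists 0%N.
  by have [k hk] := hv x xg; exists k.
have [e he] := boolp.choice ex.
by exists (\sum_(x <- rees_gens) e x).+1; apply: (torsion_kill he).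
Qed.

End Torsion.

Lemma rees_ideal_acc : noetherian A -> ideal_acc (rees_ring I).
Proof.
move=> noethA J Ji ch.
pose N i : set {poly A} :=
  [set rees_poly p | p in (J i : set (rees (adic I)))].
have [i|i _ [p _ <-]|i _ [p Jp <-]|i0 h] := acc_rees_adic noethA IE (N := N).
- have [J0 JD JM] := Ji i; split.
    split; first by exists 0; rewrite ?rees0.
    move=> _ _ [p Jp <-] [q Jq <-]; exists (p - q); last exact: reesB.
    by apply: (subgroupB (ideal_subgroup (Ji i))).
  move=> w _ /(rees_ops_sub IE) hw [p Jp <-]; exists (mk_rees hw * p); last exact: reesM.
  exact: JM.
- exact: rees_polyP.
- by exists p => //; exact: ch.
exists i0 => i ii p Jp; have [q Jq qE] : N i0 (rees_poly (p : rees (adic I))).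
  by apply: (h i) => //; exists p.
by rewrite (rees_poly_inj (esym qE) : p = q).
Qed.

End ReesModules.

(** * The two implications *)

Section Main.
Variables (A : comNzRingType) (I : set A) (s : seq A) (F : multFiltration A).
Hypothesis noethA : noetherian A.
Hypothesis IE : I = ideal_gen [set` s].
Hypothesis IF : forall n, (1 <= n)%N -> ideal_exp I n `<=` F n.

Local Notation M := (rees_module IF).
Local Notation xs := (rees_gens I s).

Let xs1 x : x \in xs -> gring_deg 1 x := rees_gens_deg1 IE (x := x).

Lemma IF1 : I `<=` F 1%N.
Proof. by rewrite -[X in X `<=` _](ideal_exp1 IE); exact: IF. Qed.

Lemma rees_gen_scale a (v : M) : a \in s ->
  rees_poly (rees_gen I a *: v : rees F) = a *: (rees_poly (v : rees F) * 'X).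
Proof.
move=> sa; rewrite [LHS](reesM (rees_incl IF (rees_gen I a)) v) /= (rees_genE IE) //.
by rewrite -scalerAl mulrC.
Qed.

Lemma monomial_rees n b : F n b -> rees_set F (b *: 'X^n).
Proof.
move=> hb k; rewrite coefZ coefXn; case: eqP => [->|_]; rewrite ?mulr1 // mulr0.
by have [] := filt_ideal F k.
Qed.

Lemma vanishing_reduction :
    (forall i : nat, exists n0 : int, forall n : int, n0 <= n ->
       local_cohomology_deg_eq0 (rees_plus I) M i n) ->
  exists c : nat, forall n, (c <= n)%N -> F n.+1 `<=` ideal_mul I (F n).
Proof.
move=> H; have [E] := injResolution_exists M.
pose q0 := (size xs).+1.
(* The argument meets only cohomological degrees up to [q0], so finitely many bounds are
   combined. *)
have [n0 hn0] : exists n0 : int, forall q n, (q <= q0)%N -> n0 <= n ->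
    local_cohomology_deg_eq0 (rees_plus I) M q n.
  elim: q0 => [|q [n0 hn0]].
    by have [n0 h] := H 0%N; exists n0 => q n; rewrite leqn0 => /eqP ->; exact: h.
  have [n1 h] := H q.+1; exists (Num.max n0 n1) => q' n.
  rewrite ge_max leq_eqVlt => /predU1P[->|q'q] /andP[nn0 nn1]; first exact: h.
  exact: hn0.
have van q n (x : E q) : (q <= q0)%N -> n0 <= n -> gmod_deg n x ->
    ptorsion xs x -> res_diff E q x = 0 -> torsion_boundaries xs x.
  move=> qq nn dx hx dfx; have := hn0 q n qq nn E x.
  case: q x qq dx hx dfx => [|q] x qq dx hx dfx h.
    by apply: h; split=> //; split=> //; apply/(torsionP IE).
  have [|y /(torsionP IE) hy xE] := h; last by exists y.
  by split=> //; split=> //; apply/(torsionP IE).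
(* Top Koszul cochains of internal degree n + 1 - r, where r is the number of generators, take
   values in degree n + 1; this choice keeps n + 1 - r above [n0]. *)
exists (`|n0|%N + size xs)%N => n cn b Fb.
pose m : M := mk_rees (monomial_rees Fb).
have dm : gmod_deg (n.+1%:Z - (size xs)%:Z + 1 * (size xs)%:Z) m.
  rewrite mul1r subrK => k kn; rewrite /= coefZ coefXn.
  have [e|_] := eqVneq k n.+1; first by rewrite e in kn.
  by rewrite mulr0.
have nn : n0 <= n.+1%:Z - (size xs)%:Z by lia.
have [c _ mE] := @top_koszul_surjective _ 1 xs xs1 ler01 M E
  (rees_ideal_acc IE noethA) n0 q0 van _ m (ltnSn _) nn dm.
have -> : b = (rees_poly (m : rees F))`_n.+1.
  by rewrite /= coefZ coefXn eqxx mulr1.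
rewrite mE.
pose P (v : rees F) := ideal_mul I (F n) (rees_poly v)`_n.+1.
have PG : is_subgroup (P : set M).
  split; first by rewrite /P rees0 coef0; case: (ideal_mul_ideal I (F n)).
  move=> u v hu hv; rewrite /P reesB coefB.
  exact: (subgroupB (ideal_subgroup (ideal_mul_ideal _ _))).
apply: (@koszul_mem _ M P _ _ _ PG).
move=> _ t /mapP[a sa ->] _ _; rewrite /P rees_gen_scale // coefZ coefMX /=.
apply: sub_gen_smallest; exists a, (rees_poly (c t : rees F))`_n; split=> //.
  by rewrite IE; exact: sub_gen_smallest.
exact: rees_polyP.
Qed.

Hypothesis accF : acc (rees_ops s) (rees_set F).

(** [N i] consists of the elements whose class in M/R_+M lives in degrees at most [i]. Every
    monomial belongs to some [N i], hence to the stable one. *)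
Lemma acc_reduction : exists c : nat, forall n, (c <= n)%N -> F n.+1 `<=` ideal_mul I (F n).
Proof.
pose N i : set {poly A} := [set p | rees_set F p /\
  forall k, (i <= k)%N -> ideal_mul I (F k) p`_k.+1].
have [i|i p []//|i p [hp Np]|c hc] := accF (N := N).
- have [RG [_ RM]] := rees_subringW F; split.
    split; first split=> [|k _]; first exact: (subgroup0 RG).
      by rewrite coef0; case: (ideal_mul_ideal I (F k)).
    move=> p q [hp Np] [hq Nq]; split; first exact: (subgroupB RG).
    move=> k ik; rewrite coefB.
    by apply: (subgroupB (ideal_subgroup (ideal_mul_ideal _ _))); [exact: Np|exact: Nq].
  have opsF : rees_ops s `<=` rees_set F.
    move=> w /(rees_ops_sub IE) hw [|n]; first by rewrite filt0.
    exact: IF (hw n.+1).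
  move=> w p hw [hp Np]; split; first by apply: RM => //; exact: opsF.
  move=> k ik; case: hw => [[a ->]|/mapP[a sa ->]].
    by rewrite coefCM; have [_ _ h] := ideal_mul_ideal I (F k); apply: h; exact: Np.
  rewrite -scalerAl coefZ coefXM /=; apply: sub_gen_smallest.
  by exists a, p`_k; split=> //; rewrite IE; exact: sub_gen_smallest.
- by split=> // k /ltnW; exact: Np.
exists c => n cn b Fb.
have : N (maxn c n.+1) (b *: 'X^(n.+1)).
  split; first exact: monomial_rees.
  move=> k; rewrite geq_max => /andP[_ nk]; rewrite coefZ coefXn eqSS.
  rewrite gtn_eqF // mulr0; by case: (ideal_mul_ideal I (F k)).
move=> /(hc _ (leq_maxl _ _)) [_ /(_ n cn)].
by rewrite coefZ coefXn eqxx mulr1.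
Qed.

Lemma rees_module_acc (N : nat -> set M) : (forall i, graded_submodule (N i)) ->
  (forall i, N i `<=` N i.+1) -> exists i0, forall i, (i0 <= i)%N -> N i `<=` N i0.
Proof.
move=> gN ch; pose P i : set {poly A} := [set rees_poly (p : rees F) | p in N i].
have [i|i _ [p _ <-]|i _ [p Np <-]|i0 h] := accF (N := P).
- have [[NG NZ] _] := gN i; split.
    split; first by exists 0; [exact: subgroup0|exact: rees0].
    move=> _ _ [p Np <-] [q Nq <-]; exists (p - q); last exact: reesB.
    exact: subgroupB.
  move=> w _ /(rees_ops_sub IE) hw [p Np <-].
  exists ((mk_rees hw : rees_ring I) *: p); first exact: NZ.
  exact: (reesM (rees_incl IF (mk_rees hw)) p).
- exact: rees_polyP.
- by exists p => //; exact: ch.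
exists i0 => i ii p Np; have [q Nq qE] : P i0 (rees_poly (p : rees F)).
  by apply: (h i) => //; exists p.
by rewrite (rees_poly_inj (esym qE) : p = q).
Qed.

Lemma rees_module_generated : exists bound : int, forall N : set M, graded_submodule N ->
  (forall x v, x \in xs -> N (x *: v)) -> forall n v, bound <= n -> gmod_deg n v -> N v.
Proof.
have [c hc] := acc_reduction; exists c.+1%:Z => N [[NG NZ] _] Nx n v.
case: n => // -[|n] // cn dv.
have vE : rees_poly (v : rees F) = (rees_poly (v : rees F))`_n.+1 *: 'X^(n.+1).
  apply/polyP => k; rewrite coefZ coefXn.
  have [->|kn] := eqVneq k n.+1; first by rewrite mulr1.
  by rewrite mulr0; apply: dv => -[e]; rewrite e eqxx in kn.
apply: (@rees_span A I s IE F N IF1 _ _ _ _ n (rees_poly (v : rees F))`_n.+1) => //.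
- exact: subgroup0.
- by move=> u w; exact: is_subgroupD.
- move=> a u w Nu wE.
  have ha : rees_set (adic I) a%:P by apply: (rees_ops_sub IE); left; exists a.
  suff -> : w = (mk_rees ha : rees_ring I) *: (u : M) by exact: NZ.
  apply: rees_poly_inj; rewrite wE [RHS](reesM (rees_incl IF (mk_rees ha)) u).
  by rewrite /= mul_polyC.
- move=> a u w sa wE; suff -> : w = rees_gen I a *: (u : M).
    by apply: Nx; exact: map_f.
  by apply: rees_poly_inj; rewrite wE rees_gen_scale.
- by apply: hc; [rewrite lez_nat in cn|exact: rees_polyP].
Qed.

Lemma torsion_boundaries_coboundaries k (E : injResolution M) i (x : E i) :
  torsion_boundaries [seq y ^+ k | y <- xs] x -> @lc_coboundaries _ (rees_plus I) M E i x.
Proof.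
case: i x => [|i] x //= [y hy ->]; exists y => //; apply/(torsionP IE) => g gx.
have [l hl] := hy (g ^+ k) (map_f _ gx).
by exists (k * l)%N; rewrite exprM.
Qed.

Lemma local_cohomology_vanishing (i : nat) : exists n0 : int, forall n : int, n0 <= n ->
  local_cohomology_deg_eq0 (rees_plus I) M i n.
Proof.
have [bound hb] := rees_module_generated.
have zero_graded : graded_submodule [set 0 : M].
  split; first split.
  - by split=> // _ _ -> ->; rewrite subrr.
  - by move=> a _ ->; rewrite scaler0.
  - by move=> n _ ->; rewrite hcomp0.
(* The bound is fixed before the resolution [E] and the class [z]; the exponent [k] that [z]
   requires is known only later. *)
have [n0 V] := koszul_vanishing_all xs1 rees_module_acc hb zero_graded i.
exists n0 => n nn E z [[/(torsionP IE) hz dz] degz].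
have ex x : exists k, x \in xs -> x ^+ k *: z = 0.
  have [xg|xg] := boolP (x \in xs); last by exists 0%N.
  by have [k hk] := hz x xg; exists k.
have [e he] := boolp.choice ex.
pose k := (\sum_(x <- xs) e x)%N.
pose ys := [seq x ^+ k | x <- xs].
have ysd y : y \in ys -> gring_deg k%:Z y.
  move=> /mapP[x xg ->]; rewrite -[k%:Z]mul1r.
  by apply: gring_degX; exact: xs1.
have ysz y : y \in ys -> y *: z = 0.
  move=> /mapP[x xg ->]; rewrite /k (big_rem x xg) /= addnC exprD -scalerA he //.
  by rewrite scaler0.
apply: (@torsion_boundaries_coboundaries k).
apply: (@torsion_exact _ k%:Z ys ysd M E (rees_ideal_acc IE noethA) i n _ z degz ysz dz).
move=> c; rewrite /ys size_map => hc Dc; have [|b cb bE] := V k n c nn hc; first exact: Dc.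
exists b => // s' ss ws; apply/eqP; rewrite -subr_eq0; apply/eqP; exact: bE.
Qed.

End Main.

Theorem theorem1p1 (A : comNzRingType) (noethA : noetherian A)
    (I : set A) (idealI : is_ideal I) (F : multFiltration A)
    (fgF : rees_finitely_generated F)
    (IF : forall n : nat, (1 <= n)%N -> ideal_exp I n `<=` F n) :
  (forall i : nat, exists n0 : int, forall n : int, n0 <= n ->
     local_cohomology_deg_eq0 (rees_plus I) (rees_module IF) i n)
  <->
  (forall n : nat, (1 <= n)%N -> F n `<=` integral_closure (ideal_exp I n)).
Proof.
have [s IE] := noethA I idealI; split=> [H|dep].
  have [c hc] := vanishing_reduction noethA IE H.
  by move=> n n1; exact: (reduction_integral noethA hc n1).
move=> i; apply: local_cohomology_vanishing => //; first exact: IE.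
exact: acc_rees noethA IE fgF dep.
Qed.
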